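(* Let $A\in\mathbb{R}^{n\times n}$ be a symmetric matrix whose entries are $b$-bit integers, not all $0$, and let $\epsilon,\eta>0$ be given rational numbers. There is a deterministic algorithm which on input $A,\epsilon,\eta$ runs in time $\mathrm{poly}(n,b,1/\epsilon,1/\eta)$ and behaves as follows: (a) If $|\lambda_{\max}(A)|\ge\epsilon\|A\|_F$, the algorithm outputs a number $\tilde\lambda\in\mathbb{R}_+$ and a unit vector $\tilde w\in\mathbb{R}^n$ such that (i) $(1-\eta)|\lambda_{\max}(A)|\le|\tilde\lambda|\le|\lambda_{\max}(A)|$; (ii) the matrix $\tilde B=A-\tilde\lambda\,\tilde w\tilde w^T$ satisfies $\|\tilde B\tilde w\|_2<\eta\|A\|_F$; and (iii) $\|\tilde B\|_F\le(1-\epsilon^2/40)\|A\|_F$. (b) If $|\lambda_{\max}(A)|<\epsilon\|A\|_F$, the algorithm either outputs ``small max eigenvalue'' or behaves as in case (a).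
   Context: $\lambda_{\max}(A)$ denotes an eigenvalue of $A$ of largest absolute value. $\|A\|_F=\sqrt{\sum_{i,j}A_{ij}^2}$ is the Frobenius norm.
   Formalization: The number λ̃ is required to be nonnegative only when some eigenvalue of largest absolute value is nonnegative (for A=(−1) no λ̃≥0 works), and the running time has an added term polynomial in the bit lengths of the rationals ε and η, needed to read them. *)

(* Defs.v *)
From HB Require Import structures.
From mathcomp Require Import all_boot all_order all_algebra.
From mathcomp Require Import reals.

Set Implicit Arguments.
Unset Strict Implicit.
Unset Printing Implicit Defensive.

Import Order.TTheory GRing.Theory Num.Theory.
Local Open Scope ring_scope.

(* Model of computation: structured programs over a random-access memory of
   unbounded integers, with logarithmic (bit) cost. A program refers to finitely
   many arrays, named by natural numbers; every array has a cell for each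
   integer index. *)

Definition store := nat -> int -> int.

Definition update (s : store) (a : nat) (i v : int) : store :=
  fun a' i' => if (a' == a) && (i' == i) then v else s a' i'.

Inductive expr : Type :=
| Cst of int
| Get of nat & expr
| Add of expr & expr
| Sub of expr & expr
| Mul of expr & expr
| Div of expr & expr.

Inductive cmd : Type :=
| Skip
| Assign of nat & expr & expr  (* Assign a i e : a[i] := e *)
| Seq of cmd & cmd
| If of expr & cmd & cmd       (* the test succeeds on positive values *)
| While of expr & cmd.

Fixpoint eval (s : store) (e : expr) : int :=
  match e with
  | Cst z => z
  | Get a i => s a (eval s i)
  | Add e1 e2 => eval s e1 + eval s e2
  | Sub e1 e2 => eval s e1 - eval s e2
  | Mul e1 e2 => eval s e1 * eval s e2
  | Div e1 e2 => (eval s e1 %/ eval s e2)%Z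
  end.

Definition bitlen (z : int) : nat := (trunc_log 2 `|z|).+1.

(* Addition and subtraction are charged the total length of their operands,
   multiplication and division the product of these lengths, and a memory
   access the length of the address plus that of the value read. *)
Fixpoint cost (s : store) (e : expr) : nat :=
  match e with
  | Cst z => bitlen z
  | Get a i => cost s i + (bitlen (eval s i) + bitlen (s a (eval s i)))
  | Add e1 e2 | Sub e1 e2 =>
      cost s e1 + cost s e2 + (bitlen (eval s e1) + bitlen (eval s e2))
  | Mul e1 e2 | Div e1 e2 =>
      cost s e1 + cost s e2 + bitlen (eval s e1) * bitlen (eval s e2)
  end%N.

(* exec c s s' t : started in the store s, the program c halts in the store s'
   after time t. *)
Inductive exec : cmd -> store -> store -> nat -> Prop :=
| exec_skip s : exec Skip s s 1
| exec_assign s a i e :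
    exec (Assign a i e) s (update s a (eval s i) (eval s e))
      (cost s i + cost s e + (bitlen (eval s i) + bitlen (eval s e)))
| exec_seq c1 c2 s1 s2 s3 t1 t2 :
    exec c1 s1 s2 t1 -> exec c2 s2 s3 t2 -> exec (Seq c1 c2) s1 s3 (t1 + t2)
| exec_if_true e c1 c2 s s' t :
    0 < eval s e -> exec c1 s s' t -> exec (If e c1 c2) s s' (cost s e + t)
| exec_if_false e c1 c2 s s' t :
    eval s e <= 0 -> exec c2 s s' t -> exec (If e c1 c2) s s' (cost s e + t)
| exec_while_true e c s1 s2 s3 t1 t2 :
    0 < eval s1 e -> exec c s1 s2 t1 -> exec (While e c) s2 s3 t2 ->
    exec (While e c) s1 s3 (cost s1 e + t1 + t2)
| exec_while_false e c s :
    eval s e <= 0 -> exec (While e c) s s (cost s e).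

Lemma exec_deterministic c s s1 s2 t1 t2 :
  exec c s s1 t1 -> exec c s s2 t2 -> s1 = s2 /\ t1 = t2.
Proof.
move=> H; move: s2 t2.
induction H => sz tz Hz; inversion Hz; subst; try (by []);
  try (exfalso; match goal with
       | h : is_true (0 < ?x), h' : is_true (?x <= 0) |- _ =>
           by rewrite leNgt h in h' end);
  repeat match goal with
  | IH : forall _ _, exec ?c ?s _ _ -> _, h : exec ?c ?s _ _ |- _ =>
      case: (IH _ _ h) => ? ?; subst; clear h IH
  end; by [].
Qed.

(* Input: the dimension n in array 0, the matrix in row-major order in array 1,
   the reduced fractions eps and eta in array 2; every other cell is 0. *)
Definition input_store n (A : 'M[int]_n) (eps eta : rat) : store :=
  fun a i =>
    match a, i with
    | 0%N, Posz 0 => n%:Z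
    | 1%N, Posz k =>
        match insub (k %/ n)%N, insub (k %% n)%N with
        | Some p, Some q => A p q
        | _, _ => 0
        end
    | 2%N, Posz 0 => numq eps
    | 2%N, Posz 1 => denq eps
    | 2%N, Posz 2 => numq eta
    | 2%N, Posz 3 => denq eta
    | _, _ => 0
    end.

Variant output (n : nat) : Type :=
| SmallMaxEigenvalue
| Eigenpair of rat & 'cV[rat]_n.

Arguments SmallMaxEigenvalue {n}.

(* Output: array 3 holds a flag followed by the numerator and the denominator of
   the number; arrays 4 and 5 hold the numerators and the denominators of the
   coordinates of the vector. *)
Definition read_output n (s : store) : output n :=
  if s 3%N 0 == 0 then SmallMaxEigenvalue
  else Eigenpair ((s 3%N 1)%:Q / (s 3%N 2%:Z)%:Q)
                 (\col_(i < n) ((s 4%N i%:Z)%:Q / (s 5%N i%:Z)%:Q)).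

(* Length of the binary encoding of a rational input; it is not bounded in terms
   of q^-1, so reading q is accounted for separately in running times. *)
Definition rat_bitlen (q : rat) : nat := (bitlen (numq q) + bitlen (denq q))%N.

Section Matrices.

Variable R : realType.

Definition frobenius_norm m n (A : 'M[R]_(m, n)) : R :=
  Num.sqrt (\sum_i \sum_j A i j ^+ 2).

Definition l2norm n (v : 'cV[R]_n) : R := Num.sqrt (\sum_i v i 0 ^+ 2).

(* lam is an eigenvalue of A of largest absolute value *)
Definition is_lambda_max n (A : 'M[R]_n) (lam : R) : Prop :=
  eigenvalue A lam /\ forall mu, eigenvalue A mu -> `|mu| <= `|lam|.

(* The sign requirement is [0 <= lam -> 0 <= lt] and not [0 <= lt]: for
   A = (-1) and eta <= 1, no lt >= 0 and unit vector w satisfy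
   l2norm (B *m w) < eta * frobenius_norm A. *)
Definition approx_eigenpair n (A : 'M[R]_n) (eps eta lam lt : R)
    (w : 'cV[R]_n) : Prop :=
  let B := A - lt *: (w *m w^T) in
  [/\ 0 <= lam -> 0 <= lt,
      l2norm w = 1,
      (1 - eta) * `|lam| <= `|lt| <= `|lam|,
      l2norm (B *m w) < eta * frobenius_norm A
    & frobenius_norm B <= (1 - eps ^+ 2 / 40%:R) * frobenius_norm A].

Definition outputs_approx_eigenpair n (A : 'M[R]_n) (eps eta lam : R)
    (o : output n) : Prop :=
  exists (lt : rat) (w : 'cV[rat]_n),
    o = Eigenpair lt w /\
    approx_eigenpair A eps eta lam (ratr lt) (map_mx ratr w).

End Matrices.

(* Main.v *)
(* The algorithm is the power method with exact integer arithmetic.  Let L be the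
   largest absolute value of an eigenvalue and c an integer close to the Frobenius
   norm.  For each sign sg and each coordinate i the vector v = (sg A + c)^N (K e_i)
   is computed.  The numbers |(sg A + c)^k e_i|^2 form a log-convex sequence, so if
   the final one is within a factor poly(n) of its maximal possible value
   (L + c)^(2 N), which some i and the right sign achieve, then N = poly(n, 1/eta)
   iterations force the Rayleigh quotient of v to be close to sg L.  The squared
   norms of the candidates with sg = 1 are multiplied by n, so that sg = -1 wins only
   if L is not an eigenvalue.  A rational unit vector w near the direction of v is the
   reflection of a coordinate vector, and the number returned is the exact Rayleigh
   quotient th of w: then |Bw|^2 = |Aw|^2 - th^2 <= L^2 - th^2 and
   |B|_F^2 = |A|_F^2 - th^2. *)
From mathcomp Require Import all_boot all_order all_algebra.
From mathcomp Require Import boolp classical_sets reals topology normedtype derive.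
From mathcomp Require Import zify ring lra.
Require Import Defs.

Set Implicit Arguments.
Unset Strict Implicit.
Unset Printing Implicit Defensive.

Import Order.TTheory GRing.Theory Num.Theory.
Import numFieldNormedType.Exports.
Local Open Scope ring_scope.

(** * The spectral bound for symmetric matrices *)

(** With an integer [H >= 1 / eta], the goal is a relative defect [1 / (4 H^2)] of the Rayleigh
    quotient, since [L^2 - th^2] has to stay below [eta^2 |A|_F^2]. The iterate has defect
    [1 / (64 H^2)]; passing to a unit vector multiplies it by 8 and adds an error of order
    [1 / |v|^2], which the scale [K] makes small. Dividing [v] by its norm would leave the
    rationals; the reflection needs only the integer square root of [v . v]. The flag compares
    [4 th^2] with [eps^2 |A|_F^2]: this threshold leaves room for the error of [th] in case (a), and
    passing it already implies (iii). For the running time, a single [W] bounds the bits of every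
    cell and the iterations of every loop; the time is then a constant times a power of [W], both
    read off the syntax. *)

Section DotProduct.

Variables (R : realFieldType) (n : nat).
Implicit Types (x y z : 'cV[R]_n) (A : 'M[R]_n) (a : R).

Definition dot x y : R := \sum_i x i 0 * y i 0.

Lemma dotC x y : dot x y = dot y x.
Proof. by apply: eq_bigr => i _; rewrite mulrC. Qed.

Lemma dotDl x y z : dot (x + y) z = dot x z + dot y z.
Proof. by rewrite -big_split; apply: eq_bigr => i _; rewrite mxE mulrDl. Qed.

Lemma dotDr x y z : dot x (y + z) = dot x y + dot x z.
Proof. by rewrite dotC dotDl !(dotC x). Qed.

Lemma dotZl a x y : dot (a *: x) y = a * dot x y.
Proof. by rewrite mulr_sumr; apply: eq_bigr => i _; rewrite mxE mulrA. Qed.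

Lemma dotZr a x y : dot x (a *: y) = a * dot x y.
Proof. by rewrite dotC dotZl dotC. Qed.

Lemma dot_ge0 x : 0 <= dot x x.
Proof. by apply: sumr_ge0 => i _; rewrite -expr2 sqr_ge0. Qed.

Lemma dot_eq0 x : (dot x x == 0) = (x == 0).
Proof.
apply/eqP/eqP => [x0|->]; last by rewrite /dot big1 // => i _; rewrite mxE mul0r.
apply/colP => i; rewrite mxE; apply/eqP; rewrite -sqrf_eq0 expr2; apply/eqP.
by apply: (psumr_eq0P _ x0) => // j _; rewrite -expr2 sqr_ge0.
Qed.

Lemma dot_gt0 x : (0 < dot x x) = (x != 0).
Proof. by rewrite lt0r dot_ge0 andbT dot_eq0. Qed.

Lemma dot_CauchySchwarz x y : dot x y ^+ 2 <= dot x x * dot y y.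
Proof.
have [->|y0] := eqVneq y 0.
  have -> : dot x 0 = 0 by rewrite /dot big1 // => i _; rewrite mxE mulr0.
  by rewrite expr0n /= mulr_ge0 ?dot_ge0.
have yy : 0 < dot y y by rewrite dot_gt0.
have := dot_ge0 (dot y y *: x + (- dot x y) *: y).
rewrite !dotDl !dotDr !dotZl !dotZr (dotC y x).
set p := dot x x; set q := dot x y; set r := dot y y in yy *.
have -> : r * (r * p) + r * (- q * q) + (- q * (r * q) + - q * (- q * r)) =
  r * (p * r - q ^+ 2) by ring.
by rewrite pmulr_rge0 // subr_ge0.
Qed.

Lemma dot_sym A x y : A^T = A -> dot (A *m x) y = dot x (A *m y).
Proof.
move=> Asym; rewrite /dot.
under eq_bigr => i _ do rewrite mxE mulr_suml.
under [RHS]eq_bigr => i _ do rewrite mxE mulr_sumr.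
rewrite exchange_big; apply: eq_bigr => i _; apply: eq_bigr => j _ /=.
by rewrite -[in LHS]Asym mxE mulrAC mulrC mulrA.
Qed.

End DotProduct.

Section Spectral.

Variables (R : realType) (n : nat) (A : 'M[R]_n).

(** Stated on row vectors, the form in which [EVT_max_rV] provides maxima. *)
Lemma quadratic_continuous (M : 'M[R]_n) :
  continuous (fun v : 'rV[R]_n => dot (M *m v^T) (M *m v^T)).
Proof.
have lin i : continuous (fun v : 'rV[R]_n => (M *m v^T) i 0).
  have -> : (fun v : 'rV[R]_n => (M *m v^T) i 0) =
            (fun v => \sum_j M i j * v 0 j).
    by apply/funext => v; rewrite mxE; apply: eq_bigr => j _; rewrite mxE.
  apply: (continuous_big (@add_continuous R)) => j _ v.
  by apply: continuousM; [exact: cst_continuous | exact: coord_continuous].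
by apply: (continuous_big (@add_continuous R)) => i _ v; apply: continuousM; exact: lin.
Qed.

Lemma sphere_compact : compact [set v : 'rV[R]_n | dot v^T v^T = 1].
Proof.
apply: bounded_closed_compact.
  exists 1; split=> // r r1 v /= v1; apply: le_trans (ltW r1).
  rewrite [leLHS]/Num.norm /= mx_normrE; apply: bigmax_le => // -[i j] _ /=.
  rewrite ord1 -(@ler_pXn2r _ 2) ?nnegrE // expr1n real_normK ?num_real // -v1.
  rewrite /dot (bigD1 j) //= !mxE -expr2 lerDl; apply: sumr_ge0 => k _.
  by rewrite -expr2 sqr_ge0.
have -> : [set v : 'rV[R]_n | dot v^T v^T = 1]%classic =
    ((fun v : 'rV[R]_n => dot (1%:M *m v^T) (1%:M *m v^T)) @^-1` [set 1])%classic.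
  by apply/funext => v /=; rewrite mul1mx.
by apply: closed_comp => [v _|]; [exact: quadratic_continuous | exact: closed_eq].
Qed.

(** A variational argument: [c] is the maximum of [|Ax|^2] on the unit sphere, attained at [x]. The
    nonnegative form [c |y|^2 - |Ay|^2] vanishes at [x], so its derivative there vanishes too; the
    direction [c x - A(Ax)] shows that this vector is zero. *)
Lemma quadratic_form_max : A^T = A -> (0 < n)%N ->
  exists2 x : 'cV[R]_n, x != 0 & exists2 c, 0 <= c &
    A *m (A *m x) = c *: x /\ forall y, dot (A *m y) (A *m y) <= c * dot y y.
Proof.
move=> Asym n0.
have [|v v1 vmax] := EVT_max_rV _ sphere_compact
    (continuous_subspaceT (@quadratic_continuous A)).
  exists (delta_mx 0 (Ordinal n0)) => /=.
  rewrite /dot (bigD1 (Ordinal n0)) //= big1 ?addr0 ?mxE ?eqxx ?mulr1 //.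
  by move=> i /negbTE ine; rewrite !mxE ine mulr0n mul0r.
move: v1; rewrite inE /= => v1.
set x := v^T in v1 vmax; set c := dot (A *m x) (A *m x).
have x0 : x != 0 by rewrite -dot_gt0 v1 ltr01.
have maxc y : dot (A *m y) (A *m y) <= c * dot y y.
  have [->|y0] := eqVneq y 0.
    by rewrite mulmx0 /dot !big1 ?mulr0 // => i _; rewrite mxE mul0r.
  have yy : 0 < dot y y by rewrite dot_gt0.
  have r0 : 0 < Num.sqrt (dot y y) by rewrite sqrtr_gt0.
  have /vmax : ((Num.sqrt (dot y y))^-1 *: y)^T \in
      [set v : 'rV[R]_n | dot v^T v^T = 1]%classic.
    rewrite inE /= trmxK dotZl dotZr mulrA -expr2 exprVn sqr_sqrtr ?(ltW yy) //.
    by rewrite mulVf ?gt_eqF.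
  rewrite trmxK -scalemxAr dotZl dotZr mulrA -expr2 exprVn sqr_sqrtr ?(ltW yy) //.
  by rewrite ler_pdivrMl // mulrC.
exists x => //; exists c; first exact: dot_ge0.
split=> //; apply/eqP; rewrite eq_sym -subr_eq0; apply/negPn.
set y := _ - _; rewrite -dot_gt0; apply/negP => d0.
set d := dot y y in d0.
pose e := c * d - dot (A *m y) (A *m y).
have e0 : 0 <= e by rewrite subr_ge0 maxc.
have dE : d = c * dot x y - dot (A *m x) (A *m y).
  by rewrite /d {1}/y dotDl -scaleN1r !dotZl mulN1r dot_sym // -dot_sym.
have key t : 0 <= 2 * t * d + t ^+ 2 * e.
  have := maxc (x + t *: y); rewrite mulmxDr -scalemxAr -subr_ge0.
  rewrite !dotDl !dotDr !dotZl !dotZr v1 -/c -/d (dotC y x) (dotC (A *m y) (A *m x)).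
  suff -> : 2 * t * d = 2 * t * (c * dot x y - dot (A *m x) (A *m y)).
    by congr (_ <= _); rewrite /e; ring.
  by rewrite -dE.
have e1 : 0 < e + 1 by rewrite ltr_wpDl.
(* A small negative [t] lets the linear term win; [e + 1] replaces [e] because [e] may be zero. *)
have := key (- (d / (e + 1))).
have -> : 2 * - (d / (e + 1)) * d + (- (d / (e + 1))) ^+ 2 * e =
    - ((d / (e + 1)) ^+ 2 * (e + 2)) by field; rewrite gt_eqF.
rewrite oppr_ge0 leNgt mulr_gt0 ?exprn_gt0 ?divr_gt0 //.
by rewrite ltr_wpDl.
Qed.

(** [eigenvalue] speaks of row vectors; symmetry lets column eigenvectors be transposed. *)
Lemma eigenvalue_sym lam (x : 'cV[R]_n) :
  A^T = A -> x != 0 -> A *m x = lam *: x -> eigenvalue A lam.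
Proof.
move=> Asym x0 Ax; apply/eigenvalueP; exists x^T; last by rewrite trmx_eq0.
by rewrite -[in LHS]Asym -trmx_mul Ax linearZ.
Qed.

(** With [s] the root of the maximum [c], the maximizer satisfies [(A - s)(A + s) z = 0]. Either
    [(A + s) z = 0] and [-s] is an eigenvalue, or [(A + s) z] is an eigenvector for [s]; in both
    cases [s <= |lam|]. *)
Lemma lambda_max_bound lam (x : 'cV[R]_n) : A^T = A -> is_lambda_max A lam ->
  dot (A *m x) (A *m x) <= lam ^+ 2 * dot x x.
Proof.
move=> Asym [_ lam_max].
have [n0|n0] := posnP n.
  by rewrite /dot !big1 ?mulr0 // => i _; have := ltn_ord i; rewrite {2}n0.
have [z z0 [c c0 [Az max_c]]] := quadratic_form_max Asym n0.
have c2 : Num.sqrt c ^+ 2 = c by rewrite sqr_sqrtr.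
apply: le_trans (max_c x) _; apply: ler_wpM2r; first exact: dot_ge0.
suff : `|Num.sqrt c| <= `|lam|.
  move=> sqrt_c_le; rewrite -[leLHS]c2 -[leLHS]real_normK ?num_real //.
  by rewrite -[leRHS]real_normK ?num_real // ler_pXn2r ?nnegrE.
have [y0|y0] := eqVneq (A *m z + Num.sqrt c *: z) 0.
  rewrite -normrN; apply/lam_max/(eigenvalue_sym Asym z0).
  by apply/eqP; rewrite scaleNr -addr_eq0 y0.
apply/lam_max/(eigenvalue_sym Asym y0).
by rewrite mulmxDr -scalemxAr Az scalerDr scalerA -expr2 c2 addrC.
Qed.
End Spectral.

(** * The power method *)

(** Log-convexity makes the ratios [b k.+1 / b k] nondecreasing, so a bound on the last one holds
    for all of them, and their product telescopes. *)
Lemma log_convex_ratio (R : realFieldType) (b : nat -> R) (rho : R) N :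
  (forall k, 0 <= b k) -> (forall k, b k.+1 ^+ 2 <= b k * b k.+2) ->
  0 <= rho -> 0 < b N -> b N.+1 <= rho * b N -> b N <= rho ^+ N * b 0%N.
Proof.
move=> b0 bc rho0; elim: N => [|N IH] bN; first by rewrite expr0 mul1r.
move=> bN1.
have bNN : b N.+1 <= rho * b N.
  have := le_trans (bc N) (ler_wpM2l (b0 N) bN1).
  by rewrite expr2 mulrCA mulrA ler_pM2r.
have {}IH : b N <= rho ^+ N * b 0%N.
  apply: IH bNN; rewrite lt0r b0 andbT; apply/eqP => bN0.
  by move: (bc N); rewrite bN0 mul0r leNgt exprn_gt0.
by apply: le_trans bNN _; rewrite exprS -mulrA ler_wpM2l.
Qed.

Section PowerMethod.

Variables (R : realFieldType) (n : nat) (A : 'M[R]_n) (L c sg : R).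
Implicit Types u v x y : 'cV[R]_n.
Hypotheses (Asym : A^T = A) (sg2 : sg ^+ 2 = 1) (L_ge0 : 0 <= L) (c_ge0 : 0 <= c).
Hypothesis A_le : forall x, dot (A *m x) (A *m x) <= L ^+ 2 * dot x x.

Let M : 'M[R]_n := sg *: A + c%:M.
Let mu := L + c.

Lemma rayleigh_le x : sg * dot x (A *m x) <= L * dot x x.
Proof.
have rhs0 : 0 <= L * dot x x by rewrite mulr_ge0 ?dot_ge0.
have [lhs0|lhs0] := lerP (sg * dot x (A *m x)) 0; first exact: le_trans rhs0.
rewrite -(@ler_pXn2r _ 2) ?nnegrE ?(ltW lhs0) // exprMn sg2 mul1r.
apply: le_trans (dot_CauchySchwarz _ _) _.
by rewrite mulrC exprMn [dot x x ^+ 2]expr2 mulrA ler_wpM2r ?dot_ge0.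
Qed.

Lemma shift_mulmx (x : 'cV[R]_n) : M *m x = sg *: (A *m x) + c *: x.
Proof. by rewrite mulmxDl -scalemxAl mul_scalar_mx. Qed.

Lemma shift_sym : M^T = M.
Proof. by rewrite linearD /= linearZ /= tr_scalar_mx Asym. Qed.

Lemma dot_shift x : dot (M *m x) (M *m x) =
  dot (A *m x) (A *m x) + 2 * c * (sg * dot x (A *m x)) + c ^+ 2 * dot x x.
Proof.
rewrite shift_mulmx !dotDl !dotDr !dotZl !dotZr (dotC (A *m x) x).
rewrite [sg * (sg * _)]mulrA -expr2 sg2; ring.
Qed.

Lemma shift_le x : dot (M *m x) (M *m x) <= mu ^+ 2 * dot x x.
Proof.
rewrite dot_shift.
have := A_le x; have := ler_wpM2l c_ge0 (rayleigh_le x); rewrite /mu.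
by move: (dot (A *m x) _) (sg * _) (dot x x) => a q s; lra.
Qed.

Definition powit k (x : 'cV[R]_n) := iter k (mulmx M) x.

Lemma powit_le k x :
  dot (powit k x) (powit k x) <= mu ^+ (2 * k) * dot x x.
Proof.
elim: k => [|k IH]; first by rewrite expr0 mul1r.
apply: le_trans (shift_le _) _.
by rewrite mulnS exprD -[leRHS]mulrA ler_wpM2l ?sqr_ge0.
Qed.

(** Moving one factor [M] across the product puts Cauchy-Schwarz in position to give log-convexity
    of the squared norms. *)
Lemma dot_powitS k x : dot (powit k.+1 x) (powit k.+1 x) =
  dot (powit k x) (powit k.+2 x).
Proof. by rewrite /= dot_sym // shift_sym. Qed.

(** By contraposition: a final growth factor below [rho] would force all earlier ones below it,
    leaving the last iterate too short. *)
Lemma powit_ratio N rho x : 0 <= rho ->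
  rho ^+ N * dot x x < dot (powit N x) (powit N x) ->
  rho * dot (powit N x) (powit N x) <= dot (powit N.+1 x) (powit N.+1 x).
Proof.
move=> rho0 big; rewrite leNgt; apply/negP => small.
move: big; rewrite ltNge => /negP; apply.
pose b k := dot (powit k x) (powit k x).
apply: (@log_convex_ratio _ b) (ltW small) => [k|k||]; rewrite ?dot_ge0 //.
  by rewrite {1}/b dot_powitS; exact: dot_CauchySchwarz.
rewrite lt0r dot_ge0 andbT; apply/eqP => bN.
by move: small; rewrite -/(b N) bN mulr0 ltNge dot_ge0.
Qed.

(** In the expansion of [|Mv|^2], the terms [|Av|^2] and [c^2 |v|^2] cannot exceed their share of
    [mu^2 |v|^2], so the whole deficit bounds that of the cross term [2 c sg (v . Av)]; hence the
    division by [2 c]. *)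
Lemma rayleigh_of_ratio d v : 0 < c ->
  (1 - d) * mu ^+ 2 * dot v v <= dot (M *m v) (M *m v) ->
  L * dot v v - sg * dot v (A *m v) <= d * mu ^+ 2 / (2 * c) * dot v v.
Proof.
move=> c0; rewrite dot_shift; have := A_le v; rewrite /mu.
move: (dot (A *m v) _) (sg * _) (dot v v) => a q s ha h.
rewrite mulrAC ler_pdivlMr; last by lra.
by lra.
Qed.

Lemma powit_eigen u k x : A *m u = (sg * L) *: u ->
  dot u (powit k x) = mu ^+ k * dot u x.
Proof.
move=> Au; have Mu : M *m u = mu *: u.
  by rewrite shift_mulmx Au scalerA mulrA -expr2 sg2 mul1r -scalerDl.
elim: k => [|k IH] /=; first by rewrite mul1r.
by rewrite -dot_sym ?shift_sym // Mu dotZl IH exprS mulrA.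
Qed.

(** Each step multiplies the product with [u] by exactly [mu]. The start [K e_i] contributes
    [K u_i], and summing Cauchy-Schwarz over all [i] recovers [|u|^2]. Trying every coordinate thus
    replaces a random start. *)
Lemma sum_powit_ge u k (K : R) : u != 0 -> A *m u = (sg * L) *: u ->
  mu ^+ (2 * k) * K ^+ 2 <=
  \sum_i dot (powit k (K *: delta_mx i 0)) (powit k (K *: delta_mx i 0)).
Proof.
move=> u0 Au; rewrite -(@ler_pM2r _ (dot u u)) ?dot_gt0 // mulr_suml.
rewrite [in leLHS]/dot mulr_sumr; apply: ler_sum => i _.
have := dot_CauchySchwarz u (powit k (K *: delta_mx i 0)).
rewrite (powit_eigen _ _ Au) dotZr.
have -> : dot u (delta_mx i 0) = u i 0.
  rewrite /dot (bigD1 i) //= big1 ?addr0 ?mxE ?eqxx ?mulr1 //.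
  by move=> j /negbTE ji; rewrite mxE ji mulr0.
by rewrite [dot u u * _]mulrC; congr (_ <= _); rewrite mulnC exprM; ring.
Qed.

(* [L x.x - sg x.Ax] is a positive semidefinite form, so it obeys the
   parallelogram inequality. *)
Lemma defect_add x y :
  L * dot (x + y) (x + y) - sg * dot (x + y) (A *m (x + y)) <=
  2 * (L * dot x x - sg * dot x (A *m x)) + 2 * (L * dot y y - sg * dot y (A *m y)).
Proof.
have := rayleigh_le (x + (-1) *: y).
rewrite !mulmxDr -!scalemxAr !dotDl !dotDr !dotZl !dotZr (dotC y x).
by rewrite -(dot_sym y x Asym) (dotC (A *m y) x); lra.
Qed.

End PowerMethod.

(** * Unit vectors and deflation *)

Lemma dot_deltal (R : realFieldType) n (j : 'I_n) (x : 'cV[R]_n) :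
  dot (delta_mx j 0) x = x j 0.
Proof.
rewrite /dot (bigD1 j) //= big1 ?addr0 ?mxE ?eqxx ?mul1r //.
by move=> i /negbTE ij; rewrite mxE ij mul0r.
Qed.

(** Parallelogram inequality for [b v = w - a e]: the vector [2 a e + b v] in the proof is
    [w + a e]. *)
Lemma dot_combination_le (R : realFieldType) n (e v w : 'cV[R]_n) a b :
  w = a *: e + b *: v -> dot w w = 1 -> dot e e = 1 ->
  b ^+ 2 * dot v v <= 2 + 2 * a ^+ 2.
Proof.
move=> -> ; rewrite !dotDl !dotDr !dotZl !dotZr (dotC v e) => w1 e1.
have := dot_ge0 ((2 * a) *: e + b *: v).
rewrite !dotDl !dotDr !dotZl !dotZr (dotC v e); move: w1; rewrite e1.
by move: (dot e v) (dot v v) => p q; lra.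
Qed.

(* The image of the coordinate vector [e_j] under the reflection that maps [u] to
   [- u], where [u] is a perturbation of [v]: an exact unit vector, with rational
   coordinates if [v] and [m] are rational, close to a multiple of [v] if [m ^+ 2]
   is close to [dot v v]. *)
Definition householder (R : realFieldType) n (j : 'I_n) (v : 'cV[R]_n) (m : R) :=
  let u := v + m *: delta_mx j 0 in
  delta_mx j 0 - (2 * u j 0 / dot u u) *: u.

Section Householder.

Variables (R : realFieldType) (n : nat) (j : 'I_n) (v : 'cV[R]_n) (m : R).
Hypotheses (S_gt0 : 0 < dot v v) (m_le : m ^+ 2 <= dot v v)
  (m_ge : dot v v <= m ^+ 2 + 2 * `|m|) (mv_ge0 : 0 <= m * v j 0).

Let e : 'cV[R]_n := delta_mx j 0.
Let u := v + m *: e.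
Let w := householder j v m.
Let alpha := (dot v v - m ^+ 2) / dot u u.

Lemma householder_dot : dot u u = dot v v + 2 * m * v j 0 + m ^+ 2.
Proof.
rewrite !dotDl !dotDr !dotZl !dotZr (dotC v e) !dot_deltal mxE !eqxx /=.
ring.
Qed.

(** The sign condition on [m] rules out cancellation in [v + m e_j]. *)
Lemma householder_dot_ge : dot v v <= dot u u.
Proof. by rewrite householder_dot; have := sqr_ge0 m; move: mv_ge0; lra. Qed.

Lemma householder_dot_gt0 : 0 < dot u u.
Proof. exact: lt_le_trans householder_dot_ge. Qed.

Lemma householder_unit : dot w w = 1.
Proof.
rewrite /w /householder -/e -/u; move: (u) householder_dot_gt0 => u' uu.
rewrite -scaleNr !dotDl !dotDr !dotZl !dotZr (dotC u' e) !dot_deltal.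
rewrite [e j 0]mxE !eqxx /=; move: (dot u' u') (u' j 0) uu => d x d0.
by field; rewrite gt_eqF.
Qed.

(** The coefficient [alpha] measures how far [m ^+ 2] is from [dot v v]; it vanishes when [|m|] is
    exactly the norm of [v]. *)
Lemma householderE : w = alpha *: e + (- (2 * u j 0 / dot u u)) *: v.
Proof.
have uu := householder_dot_gt0.
apply/colP => i; rewrite /w /householder -/e -/u /alpha; move: uu; rewrite householder_dot.
rewrite ![_ i 0]mxE [u j 0]mxE [(m *: e) j 0]mxE [e j 0]mxE !eqxx /=.
rewrite !mxE !eqxx !andbT; move: (v j 0) (v i 0) ((i == j)%:R) (dot v v).
by move=> x y t s s0; field; rewrite gt_eqF.
Qed.

(** For an integer square root the numerator of [alpha] is at most [2 |m|], and the denominator is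
    at least [dot v v >= m^2]; so [alpha] is of order [1 / |v|]. *)
Lemma householder_alpha : 0 <= alpha <= 1 /\ alpha ^+ 2 * dot v v <= 4.
Proof.
have uu := householder_dot_gt0; have uge := householder_dot_ge.
have a0 : 0 <= alpha by rewrite divr_ge0 ?subr_ge0 // ltW.
have a1 : alpha <= 1.
  by rewrite ler_pdivrMr // mul1r; have := sqr_ge0 m; lra.
rewrite a0 a1; split=> //.
have : alpha * dot u u = dot v v - m ^+ 2 by rewrite divfK // gt_eqF.
have k2 : `|m| ^+ 2 = m ^+ 2 by rewrite real_normK ?num_real.
have k0 : 0 <= `|m| by [].
move=> ha.
have h3 : alpha * dot v v <= 2 * `|m|.
  apply: le_trans (ler_wpM2l a0 uge) _.
  by rewrite ha lerBlDl.
have h4 : (alpha * dot v v) ^+ 2 <= 4 * dot v v.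
  apply: (@le_trans _ _ ((2 * `|m|) ^+ 2)); last first.
    by rewrite exprMn k2 -natrX ler_pM2l.
  rewrite lerXn2r ?nnegrE //; last by rewrite mulr_ge0.
  by rewrite mulr_ge0 // ltW.
by rewrite -(ler_pM2r S_gt0) -mulrA -expr2 -exprMn.
Qed.

(** [defect_add] splits the defect of [w = alpha e + beta v]. The part of [e] costs
    [2 alpha^2 * 2 L] with [alpha^2 <= 4 / |v|^2]; the part of [v] costs [2 beta^2 kappa L |v|^2]
    with [beta^2 |v|^2 <= 4]. *)
Lemma householder_defect (A : 'M[R]_n) (L sg kappa : R) :
  A^T = A -> sg ^+ 2 = 1 -> 0 <= L ->
  (forall x, dot (A *m x) (A *m x) <= L ^+ 2 * dot x x) ->
  L * dot v v - sg * dot v (A *m v) <= kappa * L * dot v v ->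
  L - sg * dot w (A *m w) <= 16 * L / dot v v + 8 * kappa * L.
Proof.
move=> Asym sg2 L0 AL Dv.
have [/andP[a0 a1] a2] := householder_alpha.
have Dw := defect_add Asym sg2 L0 AL (alpha *: e)
  ((- (2 * u j 0 / dot u u)) *: v).
move: Dw; rewrite -householderE householder_unit mulr1.
rewrite -!scalemxAr !dotZl !dotZr.
set beta := - (2 * u j 0 / dot u u); move=> Dw.
have bS : beta ^+ 2 * dot v v <= 4.
  have ee : dot e e = 1 by rewrite dot_deltal mxE !eqxx.
  apply: le_trans (dot_combination_le householderE householder_unit ee) _.
  have : alpha ^+ 2 <= 1 by rewrite expr_le1.
  by lra.
have De : L * dot e e - sg * dot e (A *m e) <= 2 * L.
  have sg2' : (- sg) ^+ 2 = 1 by rewrite sqrrN.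
  have := rayleigh_le sg2' L0 AL e; rewrite mulNr.
  have -> : dot e e = 1 by rewrite dot_deltal mxE !eqxx.
  by lra.
have k0 : 0 <= kappa * L.
  have := rayleigh_le sg2 L0 AL v; rewrite -subr_ge0 => h.
  by move: (le_trans h Dv); rewrite pmulr_lge0.
have a3 : alpha ^+ 2 <= 4 / dot v v by rewrite ler_pdivlMr.
have t1 := ler_wpM2l (sqr_ge0 alpha) De.
have t2 := ler_wpM2l (sqr_ge0 beta) Dv.
have t3 := ler_wpM2r k0 bS.
have t4 := ler_wpM2r L0 a3.
have -> : 16 * L / dot v v = 4 * (4 / dot v v * L) by rewrite mulrAC; ring.
apply: le_trans Dw _.
move: t1 t2 t3 t4; move: (4 / dot v v) (dot e (A *m e)) (dot e e).
move: (dot v (A *m v)) (dot v v) => *; lra.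
Qed.

End Householder.

Section Deflation.

Variables (R : realType) (n : nat) (A : 'M[R]_n).
Implicit Types w x : 'cV[R]_n.

Lemma l2normE x : l2norm x = Num.sqrt (dot x x).
Proof. by congr Num.sqrt; apply: eq_bigr => i _; rewrite expr2. Qed.

Lemma deflation_mulmx w : dot w w = 1 ->
  let th := dot w (A *m w) in
  (A - th *: (w *m w^T)) *m w = A *m w - th *: w.
Proof.
move=> w1 th; rewrite mulmxBl -scalemxAl -mulmxA.
suff -> : w^T *m w = 1%:M by rewrite mulmx1.
apply/matrixP => i k; rewrite !ord1 !mxE eqxx -w1.
by apply: eq_bigr => l _; rewrite mxE.
Qed.

Lemma deflation_residual w : dot w w = 1 -> let th := dot w (A *m w) in
  dot (A *m w - th *: w) (A *m w - th *: w) = dot (A *m w) (A *m w) - th ^+ 2.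
Proof.
move=> w1 th; rewrite -scaleNr !dotDl !dotDr !dotZl !dotZr w1 (dotC _ w) -/th.
by ring.
Qed.

(** Pythagoras for the Frobenius inner product: [w *m w^T] has norm one there, and [th] is the
    coefficient of [A] along it. *)
Lemma deflation_frobenius w : dot w w = 1 -> let th := dot w (A *m w) in
  \sum_i \sum_k (A - th *: (w *m w^T)) i k ^+ 2 =
  \sum_i \sum_k A i k ^+ 2 - th ^+ 2.
Proof.
move=> w1 th.
have E i k : (A - th *: (w *m w^T)) i k ^+ 2 =
    A i k ^+ 2 - 2 * th * (w i 0 * (A i k * w k 0))
    + th ^+ 2 * (w i 0 * w i 0 * (w k 0 * w k 0)).
  by rewrite !mxE big_ord1 !mxE; ring.
under eq_bigr => i _ do under eq_bigr => k _ do rewrite E.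
under eq_bigr => i _ do rewrite big_split sumrB /= -!mulr_sumr.
rewrite big_split sumrB /= -!mulr_sumr.
have -> : \sum_i w i 0 * (\sum_k A i k * w k 0) = th.
  by apply: eq_bigr => i _; rewrite mxE.
under [X in _ + _ * X]eq_bigr => i _ do rewrite -/(dot w w) w1 mulr1.
by rewrite -/(dot w w) w1; ring.
Qed.

Lemma sum_dot_delta :
  \sum_i dot (A *m delta_mx i 0) (A *m delta_mx i 0) = \sum_i \sum_k A i k ^+ 2.
Proof.
rewrite exchange_big; apply: eq_bigr => i _; apply: eq_bigr => k _.
by rewrite -colE mxE expr2.
Qed.

Lemma frobenius_le L : (forall x, dot (A *m x) (A *m x) <= L ^+ 2 * dot x x) ->
  \sum_i \sum_k A i k ^+ 2 <= n%:R * L ^+ 2.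
Proof.
move=> AL; rewrite -sum_dot_delta.
apply: (@le_trans _ _ (\sum_(i < n) L ^+ 2)); last first.
  by rewrite sumr_const card_ord mulr_natl.
apply: ler_sum => i _; apply: le_trans (AL _) _.
by rewrite dot_deltal mxE !eqxx mulr1.
Qed.

Lemma frobenius_ge x :
  dot (A *m x) (A *m x) <= (\sum_i \sum_k A i k ^+ 2) * dot x x.
Proof.
rewrite [leLHS]/dot mulr_suml; apply: ler_sum => i _.
have := dot_CauchySchwarz (row i A)^T x; rewrite -expr2.
have -> : dot (row i A)^T x = (A *m x) i 0.
  by rewrite mxE; apply: eq_bigr => k _; rewrite !mxE.
by have -> : dot (row i A)^T (row i A)^T = \sum_k A i k ^+ 2
  by apply: eq_bigr => k _; rewrite !mxE expr2.
Qed.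

End Deflation.

(** * The selected candidate *)

(** A rational substitute for an exponential estimate. It yields decay like [1 / (N d)] only, which
    costs a polynomial factor in the number of iterations. *)
Lemma bernoulli_inv (R : realFieldType) (d : R) N : 0 <= d <= 1 ->
  (1 - d) ^+ N * (1 + N%:R * d) <= 1.
Proof.
move=> /andP[d0 d1]; elim: N => [|N IH]; first by rewrite mul0r addr0 mulr1.
apply: le_trans IH; rewrite exprSr -mulrA ler_wpM2l ?exprn_ge0 ?subr_ge0 //.
rewrite -natr1; have := ler0n R N; move: (N%:R) => m m0.
have : 0 <= m * d ^+ 2 by rewrite mulr_ge0 ?sqr_ge0.
by have := sqr_ge0 d; lra.
Qed.

Section Selection.

Variables (R : realType) (n : nat) (A : 'M[R]_n) (lam c K : R) (N : nat).
Hypotheses (Asym : A^T = A) (lam_max : is_lambda_max A lam) (n_gt0 : (0 < n)%N).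
Hypotheses (c_gt0 : 0 < c).

Let L : R := `|lam|.
Let v sg i := powit A c sg N (K *: delta_mx i 0).
Let S sg i := dot (v sg i) (v sg i).

Lemma A_le x : dot (A *m x) (A *m x) <= L ^+ 2 * dot x x.
Proof. by rewrite real_normK ?num_real //; exact: lambda_max_bound. Qed.

Lemma lambda_max_eigenvector : exists2 u : 'cV[R]_n, u != 0 & A *m u = lam *: u.
Proof.
have [/eigenvalueP[r rA r0] _] := lam_max; exists r^T; first by rewrite trmx_eq0.
by rewrite -[in LHS]Asym -trmx_mul rA linearZ.
Qed.

Variables (sg om : R) (i : 'I_n).
Hypotheses (sg_om : sg = 1 /\ om = n%:R \/ sg = -1 /\ om = 1).
Hypotheses (sel_pos : forall j, n%:R * S 1 j <= om * S sg i)
  (sel_neg : forall j, S (-1) j <= om * S sg i)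
  (sel_strict : sg = -1 -> forall j, n%:R * S 1 j < S sg i).

(** For the sign [s] with [s L = lam], the [n] candidates together reach the left side, and each is
    at most [om <= n] times the selected one: one factor [n] from the sum, one from the weight. *)
Lemma selected_large : (L + c) ^+ (2 * N) * K ^+ 2 <= n%:R ^+ 2 * S sg i.
Proof.
have [u u0 Au] := lambda_max_eigenvector.
have n1 : 1 <= n%:R :> R by rewrite ler1n.
have Sge0 s j : 0 <= S s j by exact: dot_ge0.
have om_le : om <= n%:R by case: sg_om => -[_ ->].
have L0 : 0 <= L by exact: normr_ge0.
have c0 := ltW c_gt0.
have sum_le (s : R) : s ^+ 2 = 1 -> s * L = lam ->
    (forall j, S s j <= om * S sg i) ->
    (L + c) ^+ (2 * N) * K ^+ 2 <= n%:R ^+ 2 * S sg i.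
  move=> s2 sL Sle; rewrite -sL in Au.
  apply: le_trans (sum_powit_ge c Asym s2 N K u0 Au) _.
  apply: (@le_trans _ _ (\sum_(j < n) om * S sg i)).
    by apply: ler_sum => j _; exact: Sle.
  rewrite sumr_const card_ord -[leLHS]mulr_natl [n%:R ^+ 2]expr2 -[leRHS]mulrA.
  by rewrite ler_wpM2l ?ler0n // ler_wpM2r.
have [lam0|lam0] := lerP 0 lam.
  apply: (sum_le 1); rewrite ?expr1n ?mul1r /L ?ger0_norm // => j.
  by apply: le_trans (sel_pos j); rewrite ler_peMl.
by apply: (sum_le (-1)); rewrite ?sqrrN ?expr1n ?mulN1r /L ?ltr0_norm ?opprK.
Qed.

(** If [L] is an eigenvalue, the squared norms with sign 1 sum to at least [(L + c)^(2 N) K^2],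
    which no candidate of sign -1 can exceed; a strictly better negative candidate is therefore
    impossible. *)
Lemma selected_sign : 0 <= lam -> sg = 1.
Proof.
move=> lam0; case: sg_om => -[sg1 _] //.
have [u u0 Au] := lambda_max_eigenvector.
have L0 : 0 <= L by exact: normr_ge0.
have sgL : A *m u = (1 * L) *: u by rewrite Au mul1r /L ger0_norm.
have := sum_powit_ge c Asym (expr1n _ _) N K u0 sgL.
have sg2 : sg ^+ 2 = 1 by rewrite sg1 sqrrN expr1n.
have := powit_le sg2 L0 (ltW c_gt0) A_le N (K *: delta_mx i 0).
rewrite dotZl dotZr dot_deltal mxE !eqxx mulr1 -expr2 => upper lower.
have := le_trans upper lower; rewrite leNgt => /negP[].
have n1 : 0 < n%:R :> R by rewrite ltr0n.
rewrite -(ltr_pM2l n1) mulr_sumr.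
apply: (@lt_le_trans _ _ (\sum_(j < n) S sg i)); last first.
  by rewrite sumr_const card_ord -[leLHS]mulr_natl.
have := sel_strict sg1; rewrite -/(v _ _) => lt_S.
rewrite (bigD1 (Ordinal n_gt0)) //= [ltRHS](bigD1 (Ordinal n_gt0)) //=.
by apply: ltr_leD; [exact: lt_S | apply: ler_sum => j _; exact/ltW/lt_S].
Qed.

Variables (H F2 : R).
Hypotheses (H_ge1 : 1 <= H) (F2E : F2 = \sum_i \sum_j A i j ^+ 2).
Hypotheses (F2_gt0 : 0 < F2) (c2_ge : F2 <= c ^+ 2) (c2_le : c ^+ 2 <= 4 * F2).
Hypotheses (N_ge : 256 * n%:R ^+ 3 * H ^+ 2 <= N%:R) (K_gt0 : 0 < K).

Lemma lambda_max_gt0 : 0 < L.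
Proof.
rewrite lt0r normr_ge0 andbT; apply/eqP => L0.
have := frobenius_le A_le; rewrite -F2E L0 expr0n mulr0 /=.
by rewrite leNgt F2_gt0.
Qed.

Lemma lambda_max_le_frobenius : L ^+ 2 <= F2.
Proof.
have [u u0 Au] := lambda_max_eigenvector.
have := frobenius_ge A u; rewrite -F2E Au dotZl dotZr mulrA -expr2.
by rewrite ler_pM2r ?dot_gt0 // real_normK ?num_real.
Qed.

Lemma lambda_max_le_shift : L <= c.
Proof.
rewrite -(@ler_pXn2r _ 2) ?nnegrE ?(ltW c_gt0) ?normr_ge0 //.
exact: le_trans lambda_max_le_frobenius _.
Qed.

(** [c] is at most twice the Frobenius norm, itself at most [sqrt n * L]; [n] replaces [sqrt n] to
    avoid a root. *)
Lemma shift_le_lambda_max : c <= 2 * n%:R * L.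
Proof.
have n1 : 1 <= n%:R :> R by rewrite ler1n.
have L0 := ltW lambda_max_gt0.
rewrite -(@ler_pXn2r _ 2) ?nnegrE ?(ltW c_gt0) ?mulr_ge0 //.
apply: le_trans c2_le _; have := frobenius_le A_le; rewrite -F2E => F2_le.
have : n%:R * L ^+ 2 <= n%:R * (n%:R * L ^+ 2).
  by rewrite ler_peMl // mulr_ge0 ?sqr_ge0.
by move: F2_le; rewrite !exprMn; lra.
Qed.

Lemma selected_gt0 : 0 < S sg i.
Proof.
have n0 : 0 < n%:R :> R by rewrite ltr0n.
rewrite -(@pmulr_rgt0 _ (n%:R ^+ 2)) ?exprn_gt0 //.
apply: lt_le_trans selected_large; rewrite -/L.
by rewrite mulr_gt0 ?exprn_gt0 // addr_gt0 // lambda_max_gt0.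
Qed.

(** A last growth factor below [(1 - 1/p) mu^2] would, over [N >= n^2 p] steps, shorten the iterate
    by more than the factor [n^2] allowed by [selected_large]. *)
Lemma selected_defect :
  L * S sg i - sg * dot (v sg i) (A *m v sg i) <= (64 * H ^+ 2)^-1 * L * S sg i.
Proof.
have n0 : 0 < n%:R :> R by rewrite ltr0n.
have n1 : 1 <= n%:R :> R by rewrite ler1n.
have H0 : 0 < H by apply: lt_le_trans H_ge1.
have L0 := lambda_max_gt0; have Lc := lambda_max_le_shift.
have cL := shift_le_lambda_max.
have sg2 : sg ^+ 2 = 1 by case: sg_om => -[-> _]; rewrite ?sqrrN expr1n.
(* Chosen so that the final defect [4 n L / p] equals [L / (64 H^2)], and [n^2 p] is the required
   number of iterations. *)
pose p := 256 * n%:R * H ^+ 2.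
have H2 : 1 <= H ^+ 2 by rewrite exprn_ege1.
have p1 : 1 <= p.
  rewrite /p; apply: le_trans (_ : 256 * 1 * 1 <= _); first by lra.
  by rewrite ler_pM ?mulr_ge0 // ler_pM2l.
have p0 : 0 < p by lra.
have d01 : 0 <= p^-1 <= 1 by rewrite invr_ge0 ltW //= invf_le1.
have mu0 : 0 < (L + c) ^+ 2 by rewrite exprn_gt0 // addr_gt0.
have lt_n2 : (1 - p^-1) ^+ N * n%:R ^+ 2 < 1.
  have [/andP[d0 d1]] := (d01, bernoulli_inv N d01).
  have Nd : n%:R ^+ 2 <= N%:R * p^-1.
    rewrite ler_pdivlMr //; apply: le_trans N_ge.
    by rewrite le_eqVlt; apply/orP; left; apply/eqP; rewrite /p; ring.
  have : 0 <= (1 - p^-1) ^+ N by rewrite exprn_ge0 // subr_ge0.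
  rewrite le_eqVlt => /orP[/eqP <-|e0]; first by rewrite !mul0r ltr01.
  by move=> h; apply: lt_le_trans h; rewrite ltr_pM2l //; lra.
have rho0 : 0 <= (1 - p^-1) * (L + c) ^+ 2.
  by rewrite mulr_ge0 ?(ltW mu0) // subr_ge0; case/andP: d01.
have := powit_ratio Asym (A := A) (c := c) (sg := sg) (N := N)
  (x := K *: delta_mx i 0) rho0.
rewrite -/(v sg i) -/(S sg i) /= -/(powit A c sg N _) -/(v sg i) => ratio.
have {}ratio : (1 - p^-1) * (L + c) ^+ 2 * S sg i <=
    dot ((sg *: A + c%:M) *m v sg i) ((sg *: A + c%:M) *m v sg i).
  apply: ratio; rewrite dotZl dotZr dot_deltal mxE !eqxx mulr1 -expr2.
  rewrite exprMn -exprM -mulrA.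
  have X0 : 0 < (L + c) ^+ (2 * N) * K ^+ 2.
    by rewrite mulr_gt0 ?exprn_gt0 // addr_gt0.
  rewrite -(@ltr_pM2l _ (n%:R ^+ 2)) ?exprn_gt0 //.
  apply: lt_le_trans selected_large.
  rewrite [ltLHS]mulrA [n%:R ^+ 2 * _]mulrC.
  by rewrite gtr_pMl.
apply: le_trans (rayleigh_of_ratio sg2 A_le c_gt0 ratio) _.
rewrite ler_wpM2r ?dot_ge0 //.
(* [L <= c] gives [(L + c)^2 <= (2 c)^2]; afterwards [c <= 2 n L] brings the bound back to [L]. *)
apply: le_trans (_ : p^-1 * (2 * c) <= _).
  rewrite -mulrA ler_pM2l ?invr_gt0 // ler_pdivrMr ?mulr_gt0 // -expr2.
  by rewrite lerXn2r ?nnegrE ?addr_ge0 ?mulr_ge0 ?(ltW c_gt0) // ?(ltW L0) //; lra.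
rewrite mulrC ler_pdivrMr // mulrC.
apply: le_trans (_ : 4 * n%:R * L <= _); first by lra.
rewrite le_eqVlt; apply/orP; left; apply/eqP; rewrite /p.
by field; rewrite gt_eqF.
Qed.

Hypotheses (c_ge1 : 1 <= c) (K_ge : 12 * n%:R * H <= K).
Variables (j : 'I_n) (m : R).
Hypotheses (m_le : m ^+ 2 <= S sg i) (m_ge : S sg i <= m ^+ 2 + 2 * `|m|)
  (mv_ge0 : 0 <= m * v sg i j 0).

Let w := householder j (v sg i) m.
Let th := dot w (A *m w).

(** Two errors are added: the one of the iterate, multiplied by 8, and the rounding error
    [16 L / |v|^2], where [K >= 12 n H] ensures [|v|^2 >= 144 H^2]. *)
Lemma selected_rayleigh : L - sg * th <= L / (4 * H ^+ 2).
Proof.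
have n0 : 0 < n%:R :> R by rewrite ltr0n.
have H0 : 0 < H by apply: lt_le_trans H_ge1.
have L0 := lambda_max_gt0; have S0 := selected_gt0.
have sg2 : sg ^+ 2 = 1 by case: sg_om => -[-> _]; rewrite ?sqrrN expr1n.
apply: le_trans (householder_defect S0 m_le m_ge mv_ge0 Asym sg2 (ltW L0) A_le
  selected_defect) _.
have mu1 : 1 <= L + c by rewrite ler_wpDl // ltW.
have S_ge : 144 * H ^+ 2 <= S sg i.
  rewrite -(@ler_pM2l _ (n%:R ^+ 2)) ?exprn_gt0 //.
  apply: le_trans selected_large.
  apply: (@le_trans _ _ (1 * K ^+ 2)); last first.
    by rewrite ler_wpM2r ?sqr_ge0 // exprn_ege1.
  rewrite mul1r; apply: (@le_trans _ _ ((12 * n%:R * H) ^+ 2)).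
    by rewrite le_eqVlt; apply/orP; left; apply/eqP; ring.
  by rewrite lerXn2r ?nnegrE ?mulr_ge0 ?(ltW H0) ?(ltW K_gt0) ?ler0n.
have H20 : 0 < H ^+ 2 by rewrite exprn_gt0.
have t : L / S sg i <= L / (144 * H ^+ 2).
  by rewrite ler_pM2l // lef_pV2 ?posrE ?mulr_gt0.
have -> : 16 * L / dot (v sg i) (v sg i) = 16 * (L / S sg i) by rewrite mulrA.
apply: (@le_trans _ _ (16 * (L / (144 * H ^+ 2)) + 8 * (64 * H ^+ 2)^-1 * L)).
  by rewrite lerD2r ler_pM2l.
(* In units of [L / H^2]: [1/9 + 1/8 = 1/4 - 1/72]. *)
have -> : 16 * (L / (144 * H ^+ 2)) + 8 * (64 * H ^+ 2)^-1 * L =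
    L / (4 * H ^+ 2) - 1 / 72 * (L / H ^+ 2) by field; rewrite gt_eqF.
rewrite gerDl oppr_le0; have : 0 < L / H ^+ 2 by rewrite divr_gt0.
by lra.
Qed.

Lemma selected_th : 3 * L <= 4 * (sg * th) /\ sg * th <= L.
Proof.
have L0 := lambda_max_gt0.
have sg2 : sg ^+ 2 = 1 by case: sg_om => -[-> _]; rewrite ?sqrrN expr1n.
have w1 : dot w w = 1 := householder_unit selected_gt0 mv_ge0.
split; last by have := rayleigh_le sg2 (ltW L0) A_le w; rewrite w1 mulr1.
have H20 : 1 <= H ^+ 2 by rewrite exprn_ege1.
have : L / (4 * H ^+ 2) <= L / 4.
  by rewrite ler_pM2l // lef_pV2 ?posrE //; lra.
by have := selected_rayleigh; lra.
Qed.

Variables (eps eta : R).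
Hypotheses (eps_gt0 : 0 < eps) (H_eta : 1 <= H * eta) (eta_gt0 : 0 < eta).

(** The test asks only for [2 |th| >= eps |A|_F], while [|th| >= 3 L / 4]; so the flag is always
    raised in case (a). *)
Lemma selected_test : eps * frobenius_norm A <= L -> eps ^+ 2 * F2 <= 4 * th ^+ 2.
Proof.
rewrite /frobenius_norm -F2E => eL; have L0 := lambda_max_gt0.
have [th_ge _] := selected_th.
have sg2 : sg ^+ 2 = 1 by case: sg_om => -[-> _]; rewrite ?sqrrN expr1n.
have : (eps * Num.sqrt F2) ^+ 2 <= L ^+ 2.
  by rewrite lerXn2r ?nnegrE ?mulr_ge0 ?sqrtr_ge0 // ltW.
rewrite exprMn sqr_sqrtr ?(ltW F2_gt0) // => /le_trans; apply.
have : L ^+ 2 <= (2 * (sg * th)) ^+ 2.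
  by rewrite lerXn2r ?nnegrE ?(ltW L0) //; lra.
by rewrite !exprMn sg2 mul1r -natrX.
Qed.

(** Nothing is assumed about [lam] against [eps]: a raised flag alone justifies the output, which
    settles case (b) as well. *)
Lemma selected_approx : eps ^+ 2 * F2 <= 4 * th ^+ 2 ->
  approx_eigenpair A eps eta lam th w.
Proof.
move=> test; have L0 := lambda_max_gt0; have [th_ge th_le] := selected_th.
have sg2 : sg ^+ 2 = 1 by case: sg_om => -[-> _]; rewrite ?sqrrN expr1n.
have w1 : dot w w = 1 := householder_unit selected_gt0 mv_ge0.
have H0 : 0 < H by apply: lt_le_trans H_ge1.
have H20 : 0 < H ^+ 2 by rewrite exprn_gt0.
have sgth : `|th| = sg * th.
  by case: sg_om th_ge => -[-> _] th_ge; [rewrite ger0_norm | rewrite ler0_norm];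
    rewrite ?mul1r ?mulN1r // in th_ge *; lra.
have th2 : (sg * th) ^+ 2 = th ^+ 2 by rewrite exprMn sg2 mul1r.
have LF := lambda_max_le_frobenius.
have def := selected_rayleigh.
have eta2 : 1 <= H ^+ 2 * eta ^+ 2 by rewrite -exprMn exprn_ege1.
have LH : L / (4 * H ^+ 2) <= eta ^+ 2 * L / 4.
  rewrite ler_pdivrMr ?mulr_gt0 //.
  have := ler_wpM2r (ltW L0) eta2; lra.
split=> [lam0||||].
- have sg1 := selected_sign lam0; move: th_ge; rewrite sg1; lra.
- by rewrite l2normE w1 sqrtr1.
- rewrite sgth -/L th_le andbT.
  have LH1 : L / (4 * H ^+ 2) <= eta * L.
    rewrite ler_pdivrMr ?mulr_gt0 //.
    have h1 := ler_wpM2r (ltW L0) H_eta.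
    have h2 : 1 * (H * eta * L) <= H * (H * eta * L).
      by rewrite ler_wpM2r // !mulr_ge0 // ltW.
    by lra.
  lra.
- rewrite deflation_mulmx // l2normE deflation_residual // /frobenius_norm -F2E.
  have Aw := A_le w; rewrite w1 mulr1 in Aw.
  have : Num.sqrt (dot (A *m w) (A *m w) - th ^+ 2) < Num.sqrt (eta ^+ 2 * F2).
    rewrite ltr_sqrt ?mulr_gt0 ?exprn_gt0 //.
    (* The resulting [eta^2 L^2 / 2] is half of what is allowed, whence the strict inequality. *)
    have h3 : (L - sg * th) * (L + sg * th) <= eta ^+ 2 * L / 4 * (2 * L).
      apply: ler_pM; lra.
    have h4 := ler_wpM2l (sqr_ge0 eta) LF.
    have h5 : 0 < eta ^+ 2 * F2 by rewrite mulr_gt0 ?exprn_gt0.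
    by move: Aw h3 h4 h5 th2; rewrite -/th; lra.
  by rewrite sqrtrM ?sqr_ge0 // sqrtr_sqr gtr0_norm.
- rewrite /frobenius_norm deflation_frobenius // -F2E -/th.
  (* Passing the test bounds [eps], so [1 - eps^2 / 40] is nonnegative and may be moved under the
     root. The test removes [eps^2 / 4] of the squared norm, more than the [eps^2 / 20] required. *)
  have e4 : eps ^+ 2 <= 4.
    rewrite -(ler_pM2r F2_gt0); apply: le_trans test _.
    have : (sg * th) ^+ 2 <= L ^+ 2 by rewrite lerXn2r ?nnegrE ?(ltW L0) //; lra.
    by rewrite th2; lra.
  have b0 : 0 <= 1 - eps ^+ 2 / 40 by lra.
  have -> : (1 - eps ^+ 2 / 40) * Num.sqrt F2 =
      Num.sqrt ((1 - eps ^+ 2 / 40) ^+ 2 * F2).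
    by rewrite sqrtrM ?sqr_ge0 // sqrtr_sqr ger0_norm.
  rewrite ler_sqrt ?mulr_ge0 ?sqr_ge0 ?(ltW F2_gt0) //.
  have : 0 <= (eps ^+ 2 / 40) ^+ 2 * F2 by rewrite mulr_ge0 ?sqr_ge0 // ltW.
  have : 0 <= eps ^+ 2 * F2 by rewrite mulr_ge0 ?sqr_ge0 // ltW.
  by move: test; lra.
Qed.

End Selection.

(** * Weakest preconditions and running time *)

Lemma bitlen_le W (z : int) : (0 < W)%N -> (`|z| < 2 ^ W)%N -> (bitlen z <= W)%N.
Proof.
move=> W0 zW; rewrite /bitlen; case: (posnP `|z|) => [-> //|z0].
rewrite -(@ltn_exp2l 2) //; exact: leq_ltn_trans (trunc_logP _ z0) zW.
Qed.

Lemma bitlen_gt z : (`|z| < 2 ^ bitlen z)%N.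
Proof. exact: trunc_log_ltn. Qed.

Lemma absz_divz (x y : int) : (`|(x %/ y)%Z| <= `|x|)%N.
Proof.
have sg1 : (`|sgz y| <= 1)%N by case: sgzP.
by case: x => x; rewrite /divz abszM -[leqRHS]mul1n leq_mul //= ?ltnS leq_div.
Qed.

(** In a store of [W]-bit cells, [e] evaluates to at most [esize e * W] bits. A cell read counts
    like its index because any positive factor suffices there. *)
Fixpoint esize (e : expr) : nat :=
  match e with
  | Cst z => bitlen z
  | Get _ i => esize i
  | Add e1 e2 | Sub e1 e2 => esize e1 + esize e2
  | Mul e1 e2 | Div e1 e2 => esize e1 + esize e2
  end%N.

(** The factor of [W ^ 2] in the cost; the square comes from products of lengths in multiplication
    and division. *)
Fixpoint ecost (e : expr) : nat :=
  match e with
  | Cst z => bitlen z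
  | Get _ i => ecost i + (esize i + 1)
  | Add e1 e2 | Sub e1 e2 => ecost e1 + ecost e2 + (esize e1 + esize e2)
  | Mul e1 e2 | Div e1 e2 => ecost e1 + ecost e2 + esize e1 * esize e2
  end%N.

Definition bounded_store (W : nat) (s : store) := forall a i, (`|s a i| < 2 ^ W)%N.

Lemma esize_gt0 e : (0 < esize e)%N.
Proof. by elim: e => //= e1 h1 e2 h2; rewrite addn_gt0 h1. Qed.

Lemma eval_bound W s e : (0 < W)%N -> bounded_store W s ->
  (`|eval s e| < 2 ^ (esize e * W))%N.
Proof.
move=> W0 sW.
have pow a b : (0 < a)%N -> (0 < b)%N ->
    (2 ^ (a * W) + 2 ^ (b * W) <= 2 ^ ((a + b) * W))%N.
  move=> a0 b0; rewrite mulnDl expnD.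
  have h a' : (0 < a')%N -> (2 <= 2 ^ (a' * W))%N.
    by move=> a0'; rewrite -{1}(expn1 2) leq_exp2l // muln_gt0 a0'.
  by move: (h _ a0) (h _ b0); nia.
elim: e => [z|a i IH|e1 h1 e2 h2|e1 h1 e2 h2|e1 h1 e2 h2|e1 h1 e2 h2] /=.
- by apply: leq_trans (bitlen_gt z) _; rewrite leq_exp2l // leq_pmulr.
- by apply: leq_trans (sW _ _) _; rewrite leq_exp2l // leq_pmull ?esize_gt0.
- by move: (pow _ _ (esize_gt0 e1) (esize_gt0 e2)); lia.
- by move: (pow _ _ (esize_gt0 e1) (esize_gt0 e2)); lia.
- by rewrite abszM mulnDl expnD; apply: ltn_mul.
- apply: leq_ltn_trans (absz_divz _ _) _; apply: leq_trans h1 _.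
  by rewrite leq_exp2l // leq_mul2r leq_addr orbT.
Qed.

Lemma bitlen_eval W s e : (0 < W)%N -> bounded_store W s ->
  (bitlen (eval s e) <= esize e * W)%N.
Proof.
move=> W0 sW; apply: bitlen_le; first by rewrite muln_gt0 esize_gt0.
exact: eval_bound.
Qed.

Lemma cost_bound W s e : (0 < W)%N -> bounded_store W s ->
  (cost s e <= ecost e * W ^ 2)%N.
Proof.
move=> W0 sW.
have W2 x : (x * W <= x * W ^ 2)%N by rewrite leq_mul2l leq_pmulr ?orbT.
have B e' := bitlen_eval e' W0 sW.
elim: e => [z|a i IH|e1 h1 e2 h2|e1 h1 e2 h2|e1 h1 e2 h2|e1 h1 e2 h2] /=;
  rewrite ?mulnDl.
- by rewrite leq_pmulr // expn_gt0 W0.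
- apply: leq_add => //; apply: leq_add; first exact: leq_trans (W2 _).
  by apply: leq_trans (W2 _); rewrite mul1n bitlen_le.
- by apply: leq_add; [apply: leq_add | apply: leq_add; exact: leq_trans (W2 _)].
- by apply: leq_add; [apply: leq_add | apply: leq_add; exact: leq_trans (W2 _)].
- apply: leq_add; first exact: leq_add.
  by apply: leq_trans (leq_mul (B e1) (B e2)) _; rewrite mulnACA.
- apply: leq_add; first exact: leq_add.
  by apply: leq_trans (leq_mul (B e1) (B e2)) _; rewrite mulnACA.
Qed.

(* Total-correctness weakest precondition in which every stored value must have
   at most [W] bits and every loop must stop after at most [W] iterations (the
   first argument of a loop invariant is the number of iterations left). *)
Fixpoint wp (W : nat) (c : cmd) (s : store) (Q : store -> Prop) : Prop :=
  match c with
  | Skip => Q s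
  | Assign a i e =>
      (`|eval s e| < 2 ^ W)%N /\ Q (update s a (eval s i) (eval s e))
  | Seq c1 c2 => wp W c1 s (fun s1 => wp W c2 s1 Q)
  | If e c1 c2 => if 0 < eval s e then wp W c1 s Q else wp W c2 s Q
  | While e c =>
      exists I : nat -> store -> Prop,
        (exists2 m, (m <= W)%N & I m s) /\
        forall k s', I k s' ->
          if 0 < eval s' e then (0 < k)%N /\ wp W c s' (I k.-1) else Q s'
  end.

Fixpoint ccost (c : cmd) : nat :=
  match c with
  | Skip => 1
  | Assign _ i e => ecost i + ecost e + (esize i + esize e)
  | Seq c1 c2 => ccost c1 + ccost c2
  | If e c1 c2 => ecost e + (ccost c1 + ccost c2)
  | While e c => 2 * (ecost e + ccost c)
  end%N.

(** The exponent of [W] in the time: 2 for expressions, plus one for each level of loop nesting. *)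
Fixpoint depth (c : cmd) : nat :=
  match c with
  | Skip | Assign _ _ _ => 2
  | Seq c1 c2 | If _ c1 c2 => maxn (depth c1) (depth c2)
  | While _ c => (depth c).+1
  end%N.

Lemma depth_ge2 c : (2 <= depth c)%N.
Proof. by elim: c => //= [c1 h1 c2 h2|_ c1 h1 c2 h2|_ c h]; lia. Qed.

(** For a loop, an inner induction on the iterations left charges a fixed amount [X] to every
    evaluation of the test; there are at most [W + 1 <= 2 W] of them, which explains the 2 in
    [ccost]. *)
Lemma wp_sound W c s (Q : store -> Prop) : (0 < W)%N -> bounded_store W s ->
  wp W c s Q ->
  exists s' t, [/\ exec c s s' t, Q s', bounded_store W s'
                 & (t <= ccost c * W ^ depth c)%N].
Proof.
move=> W0; elim: c s Q => [|a i e|c1 IH1 c2 IH2|e c1 IH1 c2 IH2|e c IH] s Q sW /=.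
- move=> Qs; exists s, 1%N; split=> //; first exact: exec_skip.
  by rewrite mul1n expn_gt0 W0.
- move=> [eW Qs]; do 2!eexists; split; [exact: exec_assign | exact: Qs | |].
    by move=> a' i'; rewrite /update; case: ifP.
  rewrite !mulnDl; apply: leq_add; apply: leq_add; try exact: cost_bound;
    by apply: leq_trans (bitlen_eval _ W0 sW) _; rewrite leq_mul2l leq_pmulr ?orbT.
- move=> /(IH1 _ _ sW)[s1 [t1 [E1 /IH2 w2 s1W t1W]]].
  have [s2 [t2 [E2 Qs2 s2W t2W]]] := w2 s1W.
  exists s2, (t1 + t2)%N; split=> //; first exact: exec_seq E1 E2.
  rewrite mulnDl; apply: leq_add.
    by apply: leq_trans t1W _; rewrite leq_mul2l leq_pexp2l ?leq_maxl ?orbT.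
  by apply: leq_trans t2W _; rewrite leq_mul2l leq_pexp2l ?leq_maxr ?orbT.
- have d2 : (2 <= maxn (depth c1) (depth c2))%N by rewrite leq_max depth_ge2.
  have ce : (cost s e <= ecost e * W ^ maxn (depth c1) (depth c2))%N.
    apply: leq_trans (cost_bound e W0 sW) _.
    by rewrite leq_mul2l leq_pexp2l ?orbT.
  case: ltrP => [e0 /(IH1 _ _ sW)|e0 /(IH2 _ _ sW)] [s' [t [E Qs' s'W tW]]];
    exists s', (cost s e + t)%N; split=> //.
  + exact: exec_if_true.
  + rewrite mulnDl; apply: leq_add ce _; apply: leq_trans tW _.
    by apply: leq_mul; [exact: leq_addr | rewrite leq_pexp2l ?leq_maxl].
  + exact: exec_if_false.
  + rewrite mulnDl; apply: leq_add ce _; apply: leq_trans tW _.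
    by apply: leq_mul; [exact: leq_addl | rewrite leq_pexp2l ?leq_maxr].
- move=> [I [[m mW Im] Istep]].
  pose X := ((ecost e + ccost c) * W ^ depth c)%N.
  have ce s1 : bounded_store W s1 -> (cost s1 e <= ecost e * W ^ depth c)%N.
    move=> s1W; apply: leq_trans (cost_bound e W0 s1W) _.
    by rewrite leq_mul2l leq_pexp2l ?depth_ge2 ?orbT.
  suff [s' [t [E Qs' s'W tW]]] : exists s' t, [/\ exec (While e c) s s' t, Q s',
      bounded_store W s' & (t <= m.+1 * X)%N].
    exists s', t; split=> //; apply: leq_trans tW _.
    by rewrite /X expnS mulnACA leq_mul2r; apply/orP; right; lia.
  elim: m s sW Im {mW} => [|m IHm] s sW Im; have := Istep _ _ Im;
    case: ltrP => // e0.
  + by case.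
  + move=> Qs; exists s, (cost s e); split=> //; first exact: exec_while_false.
    by rewrite mul1n /X mulnDl; apply: leq_trans (ce _ sW) (leq_addr _ _).
  + move=> [_ /(IH _ _ sW)[s1 [t1 [E1 I1 s1W t1W]]]].
    have [s2 [t2 [E2 Qs2 s2W t2W]]] := IHm _ s1W I1.
    exists s2, (cost s e + t1 + t2)%N; split=> //; first exact: exec_while_true E1 E2.
    by rewrite mulSn leq_add // /X mulnDl leq_add // ce.
  + move=> Qs; exists s, (cost s e); split=> //; first exact: exec_while_false.
    apply: leq_trans (ce _ sW) _; rewrite mulSn /X mulnDl -addnA.
    exact: leq_addr.
Qed.

(** * Frame rule and counted loops *)

Fixpoint writes (c : cmd) : seq nat :=
  match c with
  | Skip => [::]
  | Assign a _ _ => [:: a]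
  | Seq c1 c2 | If _ c1 c2 => writes c1 ++ writes c2
  | While _ c => writes c
  end.

Definition agree (ws : seq nat) (s s' : store) :=
  forall a, a \notin ws -> forall i, s' a i = s a i.

Lemma agree_trans ws s1 s2 s3 : agree ws s1 s2 -> agree ws s2 s3 -> agree ws s1 s3.
Proof. by move=> h1 h2 a aw i; rewrite h2 // h1. Qed.

Lemma agree_sub ws ws' s s' : {subset ws <= ws'} -> agree ws s s' -> agree ws' s s'.
Proof. by move=> sub h a aw; apply: h; apply: contra aw; exact: sub. Qed.

Lemma agree_update ws s a i v : a \in ws -> agree ws s (update s a i v).
Proof.
move=> aw a' a'w i'; rewrite /update; case: eqP => // aa'.
by rewrite aa' aw in a'w.
Qed.

(** Specifications need mention only what changes. For loops, the invariant is strengthened by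
    agreement with the initial store outside the written arrays. *)
Lemma wp_frame W c s (Q Q' : store -> Prop) : wp W c s Q ->
  (forall s', Q s' -> agree (writes c) s s' -> Q' s') -> wp W c s Q'.
Proof.
elim: c s Q Q' => [|a i e|c1 IH1 c2 IH2|e c1 IH1 c2 IH2|e c IH] s Q Q' /=.
- by move=> Qs; apply.
- by move=> [? Qs] h; split=> //; apply: h Qs _; apply: agree_update; rewrite inE.
- move=> /IH1 w1 h; apply: w1 => s1 /IH2 w2 a1; apply: w2 => s2 Qs2 a2.
  apply: h => //; apply: (@agree_trans _ _ s1).
    by apply: agree_sub a1 => x xw; rewrite mem_cat xw.
  by apply: agree_sub a2 => x xw; rewrite mem_cat xw orbT.
- case: ifP => _ w h; [apply: IH1 w _ | apply: IH2 w _] => s' Qs' a; apply: h => //.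
    by apply: agree_sub a => x xw; rewrite mem_cat xw.
  by apply: agree_sub a => x xw; rewrite mem_cat xw orbT.
- move=> [I [[m mW Im] Istep]] h.
  exists (fun k s' => I k s' /\ agree (writes c) s s'); split; first by exists m.
  move=> k s1 [I1 a1]; have := Istep _ _ I1; case: ifP => _.
    move=> [k0 w]; split=> //; apply: IH w _ => s2 I2 a2; split=> //.
    exact: agree_trans a2.
  by move=> Qs1; exact: h.
Qed.

Definition Var (a : nat) : expr := Get a (Cst 0).

Definition For (x : nat) (len : expr) (body : cmd) : cmd :=
  Seq (Assign x (Cst 0) (Cst 0))
    (While (Sub len (Var x))
       (Seq body (Assign x (Cst 0) (Add (Var x) (Cst 1))))).

(** Here [I] counts completed iterations, whereas [wp] counts the remaining ones; the proof pairs
    them by [j + k = m]. The length is re-evaluated at each pass, so it must be insensitive to what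
    the loop writes. *)
Lemma wp_for W x len body s (Q : store -> Prop) (m : nat)
    (I : nat -> store -> Prop) :
  (m <= W)%N -> x \notin writes body ->
  (forall s', agree (x :: writes body) s s' -> eval s' len = m%:Z) ->
  (forall k s' v, I k s' -> I k (update s' x 0 v)) ->
  I 0%N s ->
  (forall k s', (k < m)%N -> agree (x :: writes body) s s' -> s' x 0 = k%:Z ->
     I k s' -> wp W body s' (I k.+1)) ->
  (forall s', agree (x :: writes body) s s' -> I m s' -> Q s') ->
  wp W (For x len body) s Q.
Proof.
move=> mW xb len_m Iupd I0 Istep Qpost; rewrite /For /=.
have W2 : (m < 2 ^ W)%N by apply: leq_ltn_trans mW _; exact: ltn_expl.
split; first by rewrite expn_gt0.
exists (fun k s' => exists j, [/\ (j + k = m)%N, s' x 0 = j%:Z,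
  agree (x :: writes body) s s' & I j s']).
split.
  exists m => //; exists 0%N; split=> //; first by rewrite /update !eqxx.
    by apply: agree_update; rewrite mem_head.
  exact: Iupd.
move=> k s1 [j [jk xj a1 Ij]]; rewrite len_m // xj subr_gt0 ltz_nat.
case: ltnP => jm; last first.
  by apply: Qpost => //; have -> : m = j by lia.
split; first by lia.
apply: wp_frame (Istep _ _ jm a1 xj Ij) _ => s2 Ij1 a2.
have x2 : s2 x 0 = j%:Z by rewrite a2.
rewrite x2; split; first by lia.
exists j.+1; split; first by lia.
- by rewrite /update !eqxx -addn1 PoszD.
- apply: agree_trans a1 _; apply: (@agree_trans _ _ s2).
    by apply: agree_sub a2 => y yw; rewrite inE yw orbT.
  by apply: agree_update; rewrite mem_head.
- exact: Iupd.
Qed.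

Arguments wp : simpl never.

Lemma wp_seq W c1 c2 s (Q : store -> Prop) :
  wp W c1 s (fun s1 => wp W c2 s1 Q) -> wp W (Seq c1 c2) s Q.
Proof. by []. Qed.

Lemma wp_assign W a i e s (Q : store -> Prop) v k :
  eval s e = v -> eval s i = k -> (`|v| < 2 ^ W)%N -> Q (update s a k v) ->
  wp W (Assign a i e) s Q.
Proof. by move=> <- <-; split. Qed.

Lemma wp_if W e c1 c2 s (Q : store -> Prop) :
  (0 < eval s e -> wp W c1 s Q) -> (eval s e <= 0 -> wp W c2 s Q) ->
  wp W (If e c1 c2) s Q.
Proof. by move=> h1 h2; rewrite /wp -/wp; case: ltrP => [/h1|/h2]. Qed.

(** * Program fragments *)

Lemma updateE s a i v : update s a i v a i = v.
Proof. by rewrite /update !eqxx. Qed.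

Lemma updateN s a i v a' i' : a' != a -> update s a i v a' i' = s a' i'.
Proof. by rewrite /update => /negbTE->. Qed.

Lemma updateNi s a i v i' : i' != i -> update s a i v a i' = s a i'.
Proof. by rewrite /update => /negbTE->; rewrite andbF. Qed.

Lemma absz_sum_le m (f : nat -> int) B : (forall k, (k < m)%N -> (`|f k| <= B)%N) ->
  (`|(\sum_(0 <= k < m) f k)%R| <= m * B)%N.
Proof.
elim: m => [|m IH] fB; first by rewrite big_geq.
rewrite big_nat_recr //=; have := IH (fun k km => fB k (ltnW km)).
by have := fB m (ltnSn m); rewrite mulSn; move: (\sum_(_ <= _ < _) _) => t; lia.
Qed.

Definition Sum (acc x : nat) (len e : expr) : cmd :=
  Seq (Assign acc (Cst 0) (Cst 0))
    (For x len (Assign acc (Cst 0) (Add (Var acc) e))).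

(** The termwise bound [B] serves the partial sums: each is stored, hence each must fit into [W]
    bits. *)
Lemma wp_sum W acc x len e s (Q : store -> Prop) m (f : nat -> int) B :
  (m <= W)%N -> x != acc ->
  (forall s', agree [:: x; acc] s s' -> eval s' len = m%:Z) ->
  (forall k s', (k < m)%N -> agree [:: x; acc] s s' -> s' x 0 = k%:Z ->
     eval s' e = f k) ->
  (forall k, (k < m)%N -> (`|f k| <= B)%N) -> (m * B < 2 ^ W)%N ->
  (forall s', agree [:: x; acc] s s' -> s' acc 0 = \sum_(0 <= k < m) f k -> Q s') ->
  wp W (Sum acc x len e) s Q.
Proof.
move=> mW xacc len_m ef fB mB post.
apply/wp_seq/(wp_assign (v := 0) (k := 0)) => //; first by rewrite expn_gt0.
have a0 : agree [:: x; acc] s (update s acc 0 0).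
  by apply: agree_update; rewrite !inE eqxx orbT.
apply: (wp_for (m := m) (I := fun k s' => s' acc 0 = \sum_(0 <= j < k) f j)) => //=.
- by rewrite inE.
- by move=> s' a; apply: len_m; exact: agree_trans a.
- by move=> k s' v; rewrite updateN // eq_sym.
- by rewrite updateE big_geq.
- move=> k s' km a xk accE.
  apply: (wp_assign (v := \sum_(0 <= j < k.+1) f j) (k := 0)) => //=.
  + by rewrite accE big_nat_recr //= (ef _ _ km (agree_trans a0 a) xk).
  + rewrite big_nat_recr //=.
    apply: leq_ltn_trans mB; apply: leq_trans (_ : (k * B + B <= _)%N); last first.
      by rewrite -mulSnr leq_mul2r km orbT.
    have := absz_sum_le (fun j jk => fB j (ltn_trans jk km)).
    by have := fB k km; move: (\sum_(_ <= _ < _) _) => t; lia.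
  + by rewrite updateE.
- by move=> s' a; apply: post; exact: agree_trans a.
Qed.

Definition Map (dst x : nat) (len e : expr) : cmd := For x len (Assign dst (Var x) e).

Lemma wp_map W dst x len e s (Q : store -> Prop) m (f : nat -> int) :
  (m <= W)%N -> x != dst ->
  (forall s', agree [:: x; dst] s s' -> eval s' len = m%:Z) ->
  (forall k s', (k < m)%N -> agree [:: x; dst] s s' -> s' x 0 = k%:Z ->
     eval s' e = f k) ->
  (forall k, (k < m)%N -> (`|f k| < 2 ^ W)%N) ->
  (forall s', agree [:: x; dst] s s' ->
     (forall k : nat, (k < m)%N -> s' dst k = f k) -> Q s') ->
  wp W (Map dst x len e) s Q.
Proof.
move=> mW xdst len_m ef fB post; rewrite /Map.
apply: (wp_for (m := m)
  (I := fun k s' => forall j : nat, (j < k)%N -> s' dst j = f j)) => //=.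
- by rewrite inE.
- by move=> k s' v Ik j jk; rewrite updateN ?Ik // eq_sym.
- move=> k s' km a xk Ik.
  apply: (wp_assign (v := f k) (k := k%:Z)); rewrite ?(ef _ _ km a xk) ?fB //.
  move=> j; rewrite ltnS leq_eqVlt => /orP[/eqP->|jk]; first by rewrite updateE.
  by rewrite updateNi ?Ik // eqz_nat ltn_eqF.
Qed.

Lemma absz_matvec_le n (c sg x : int) (f : nat -> int) BX B :
  (`|sg| <= 1)%N -> (`|x| <= BX)%N -> (forall k, (k < n)%N -> (`|f k| <= B)%N) ->
  (`|(c * x + sg * \sum_(0 <= k < n) f k)%R| <= `|c| * BX + n * B)%N.
Proof.
move=> sg1 xB /absz_sum_le; move: (\sum_(_ <= _ < _) _) => t tB.
have cx : (`|(c * x)%R| <= `|c| * BX)%N by rewrite abszM leq_mul.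
have st : (`|(sg * t)%R| <= n * B)%N by rewrite abszM -[leqRHS]mul1n leq_mul.
by move: (c * x) (sg * t) cx st => p q; lia.
Qed.

(* The arrays 10, 11 hold loop counters and 12 an accumulator. *)
Definition MatVec (dst src : nat) (sge ce : expr) : cmd :=
  For 10 (Var 0)
    (Seq (Sum 12 11 (Var 0)
            (Mul (Get 1 (Add (Mul (Var 10) (Var 0)) (Var 11))) (Get src (Var 11))))
       (Assign dst (Var 10) (Add (Mul ce (Get src (Var 10))) (Mul sge (Var 12))))).

Lemma wp_matvec W dst src sge ce s (Q : store -> Prop) (n : nat) (sg c : int)
    (a : nat -> nat -> int) (x : nat -> int) BA BX :
  (n <= W)%N -> dst \notin [:: 0; 1; 10; 11; 12; src]%N -> src \notin [:: 10; 11; 12]%N ->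
  (forall s', agree [:: 10; 11; 12; dst]%N s s' -> eval s' sge = sg) ->
  (forall s', agree [:: 10; 11; 12; dst]%N s s' -> eval s' ce = c) ->
  s 0%N 0 = n%:Z ->
  (forall i j, (i < n)%N -> (j < n)%N -> s 1%N (i * n + j)%N%:Z = a i j) ->
  (forall i, (i < n)%N -> s src i%:Z = x i) ->
  (forall i j, (i < n)%N -> (j < n)%N -> (`|a i j| <= BA)%N) ->
  (forall i, (i < n)%N -> (`|x i| <= BX)%N) ->
  (`|sg| <= 1)%N -> (`|c| * BX + n * (BA * BX) < 2 ^ W)%N ->
  (forall s', agree [:: 10; 11; 12; dst]%N s s' ->
    (forall i, (i < n)%N -> s' dst i%:Z = c * x i + sg * \sum_(0 <= j < n) a i j * x j) ->
    Q s') ->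
  wp W (MatVec dst src sge ce) s Q.
Proof.
move=> nW dst_n src_n sgeE ceE sn sa sx aB xB sg1 cB post.
move: (dst_n) (src_n); rewrite !inE !negb_or => /and5P[d0 d1 d10 d11 /andP[d12 ds]]
  /and3P[s10 s11 s12].
have sub s' : agree [:: 10; 12; 11; 12; 11; dst]%N s s' -> agree [:: 10; 11; 12; dst]%N s s'.
  by apply: agree_sub; apply/allP; rewrite /= ?inE ?eqxx ?orbT.
have N0 : 0%N \notin [:: 10; 12; 11; 12; 11; dst]%N by rewrite !inE /= eq_sym.
have N1 : 1%N \notin [:: 10; 12; 11; 12; 11; dst]%N by rewrite !inE /= eq_sym.
have Ns : src \notin [:: 10; 12; 11; 12; 11; dst]%N.
  by rewrite !inE !negb_or s10 s11 s12 eq_sym ds.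
pose y i := c * x i + sg * \sum_(0 <= j < n) a i j * x j.
apply: (wp_for (m := n)
  (I := fun k s' => forall j : nat, (j < k)%N -> s' dst j = y j)) => //=.
- by rewrite !inE /= eq_sym (negbTE d10).
- by move=> s' ag; rewrite ag.
- by move=> k s' v Ik j jk; rewrite updateN ?Ik.
- move=> k s1 kn ag1 xk Ik.
  have s1n : s1 0%N 0 = n%:Z by rewrite ag1.
  apply: wp_seq; apply: (wp_sum (m := n) (f := fun j => a k j * x j) (B := (BA * BX)%N)) => //=.
  + by move=> s' ag; rewrite ag.
  + move=> j s2 jn ag2 xj; rewrite xj.
    rewrite (ag2 10%N) // xk (ag2 0%N) // s1n.
    rewrite ag2 // ag1 // -PoszM -PoszD sa //; congr (_ * _).
    have s2n : src \notin [:: 11; 12]%N by rewrite !inE negb_or s11.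
    by rewrite (ag2 _ s2n) (ag1 _ Ns) sx.
  + by move=> j jn; rewrite abszM leq_mul ?aB ?xB.
  + by apply: leq_ltn_trans cB; rewrite leq_addl.
  + move=> s2 ag2 s2S.
    have ag12 : agree [:: 10; 11; 12; dst]%N s s2.
      apply: (@agree_trans _ _ s1); first exact: sub.
      by apply: agree_sub ag2; apply/allP; rewrite /= ?inE ?eqxx ?orbT.
    have s2k : s2 10%N 0 = k%:Z by rewrite ag2.
    have s2x : s2 src k%:Z = x k.
      by rewrite ag12 ?sx // !inE ?negb_or s10 s11 s12 /= eq_sym.
    apply: (wp_assign (v := y k) (k := k%:Z)) => //=.
    * by rewrite s2k s2x sgeE // ceE // s2S.
    * apply: leq_ltn_trans cB; apply: absz_matvec_le => [//||j jn]; first exact: xB.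
      by rewrite abszM leq_mul ?aB ?xB.
    * move=> j; rewrite ltnS leq_eqVlt => /orP[/eqP->|jk]; first by rewrite updateE.
      rewrite updateNi ?eqz_nat ?ltn_eqF // ag2 ?Ik //.
      by rewrite !inE ?negb_or d11 d12.
- by move=> s' ag Ik; apply: post => //; exact: sub.
Qed.

(* The arrays 13, 14 hold the bounds of the bisection and 15 its midpoint. *)
Definition Isqrt (e : expr) : cmd :=
  Seq (Assign 13 (Cst 0) (Cst 0))
  (Seq (Assign 14 (Cst 0) (Add e (Cst 1)))
    (While (Sub (Sub (Var 14) (Var 13)) (Cst 1))
      (Seq (Assign 15 (Cst 0) (Div (Add (Var 13) (Var 14)) (Cst 2)))
        (If (Sub (Add e (Cst 1)) (Mul (Var 15) (Var 15)))
           (Assign 13 (Cst 0) (Var 15))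
           (Assign 14 (Cst 0) (Var 15)))))).

(** Bisection with [lo^2 <= S < hi^2] and a gap of at most [2 ^ k] when [k] iterations are left; as
    [S + 1 < 2 ^ W], starting with [k = W] is enough. *)
Lemma wp_isqrt W e s (Q : store -> Prop) (S : int) :
  0 <= S -> (`|S| + 1 < 2 ^ W)%N ->
  (forall s', agree [:: 13; 14; 15]%N s s' -> eval s' e = S) ->
  (forall s' r, agree [:: 13; 14; 15]%N s s' -> s' 13%N 0 = r -> 0 <= r ->
     r ^+ 2 <= S -> S < (r + 1) ^+ 2 -> Q s') ->
  wp W (Isqrt e) s Q.
Proof.
move=> S0 SW eS post; rewrite /Isqrt.
apply/wp_seq/(wp_assign (v := 0) (k := 0)) => //; first by rewrite expn_gt0.
have a1 : agree [:: 13; 14; 15]%N s (update s 13 0 0) by exact: agree_update.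
apply/wp_seq/(wp_assign (v := S + 1) (k := 0)) => //=; rewrite ?eS //.
  by lia.
exists (fun k s' => agree [:: 13; 14; 15]%N s s' /\
  exists lo hi : int, [/\ s' 13%N 0 = lo /\ s' 14%N 0 = hi, 0 <= lo < hi,
    lo ^+ 2 <= S < hi ^+ 2, (`|hi| < 2 ^ W)%N & (`|(hi - lo)%R| <= 2 ^ k)%N]).
split.
  exists W => //; split.
    by apply: (agree_trans a1); exact: agree_update.
  exists 0, (S + 1); rewrite updateE updateN // updateE; split=> //; try lia.
move=> k s1 [ag1 [lo [hi [[h13 h14] /andP[lo0 lohi] /andP[loS Shi] hiW hk]]]].
rewrite /= h13 h14; case: ltrP => gap; last first.
  have E : hi = lo + 1 by lia.
  by apply: (post s1 lo) => //; rewrite -E.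
have k0 : (0 < k)%N.
  by case: k hk => // hk; exfalso; move: hk gap; rewrite expn0; lia.
split=> //; set mid := ((lo + hi) %/ 2%:Z)%Z.
have mid1 : lo < mid by rewrite /mid; lia.
have mid2 : mid < hi by rewrite /mid; lia.
have k2 : (2 ^ k = 2 * 2 ^ k.-1)%N by rewrite -expnS prednK.
have h1 : (`|(hi - mid)%R| <= 2 ^ k.-1)%N by move: hk; rewrite k2 /mid; lia.
have h2 : (`|(mid - lo)%R| <= 2 ^ k.-1)%N by move: hk; rewrite k2 /mid; lia.
apply/wp_seq/(wp_assign (v := mid) (k := 0)) => //=; rewrite ?h13 ?h14 //.
  by lia.
have ag2 : agree [:: 13; 14; 15]%N s (update s1 15 0 mid).
  by apply: (agree_trans ag1); exact: agree_update.
rewrite /wp /= eS // !updateE; case: ltrP => test.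
  split; first by lia.
  split; first by apply: (agree_trans ag2); exact: agree_update.
  exists mid, hi; rewrite ?updateE ?updateN //; split=> //; try lia.
split; first by lia.
split; first by apply: (agree_trans ag2); exact: agree_update.
exists lo, mid; rewrite ?updateE ?updateN //; split=> //; try lia.
Qed.

(** * The program *)

(* 16: an upper bound H of 1 / eta; 17: the scale K of the starting vectors;
   18: half the number N0 of iterations; 19: the squared Frobenius norm;
   20: the shift c. *)
Definition Setup : cmd :=
  Seq (Assign 16 (Cst 0) (Add (Div (Get 2 (Cst 3)) (Get 2 (Cst 2))) (Cst 1)))
  (Seq (Assign 17 (Cst 0) (Mul (Cst 12) (Mul (Var 0) (Var 16))))
  (Seq (Assign 18 (Cst 0) (Mul (Cst 128) (Mul (Mul (Var 0) (Mul (Var 0) (Var 0)))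
                                            (Mul (Var 16) (Var 16)))))
  (Seq (Sum 19 10 (Mul (Var 0) (Var 0)) (Mul (Get 1 (Var 10)) (Get 1 (Var 10))))
  (Seq (Isqrt (Var 19))
  (Seq (Assign 20 (Cst 0) (Add (Var 13) (Cst 1)))
       (Assign 26 (Cst 0) (Cst (- 1)))))))).

(* Candidate number t (in 21): sign in 22, weight in 23, starting coordinate in
   24; the resulting vector is in 30 and its squared norm in 25. *)
Definition Power : cmd :=
  Seq (If (Sub (Var 0) (Var 21))
         (Seq (Assign 22 (Cst 0) (Cst 1))
         (Seq (Assign 23 (Cst 0) (Var 0)) (Assign 24 (Cst 0) (Var 21))))
         (Seq (Assign 22 (Cst 0) (Cst (- 1)))
         (Seq (Assign 23 (Cst 0) (Cst 1)) (Assign 24 (Cst 0) (Sub (Var 21) (Var 0))))))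
  (Seq (Map 30 10 (Var 0) (Cst 0))
  (Seq (Assign 30 (Var 24) (Var 17))
  (Seq (For 33 (Var 18) (Seq (MatVec 31 30 (Var 22) (Var 20))
                             (MatVec 30 31 (Var 22) (Var 20))))
       (Sum 25 10 (Var 0) (Mul (Get 30 (Var 10)) (Get 30 (Var 10))))))).

(* The best candidate so far: weighted squared norm in 26, squared norm in 27,
   vector in 32. *)
Definition Keep : cmd :=
  If (Sub (Mul (Var 23) (Var 25)) (Var 26))
    (Seq (Assign 26 (Cst 0) (Mul (Var 23) (Var 25)))
    (Seq (Assign 27 (Cst 0) (Var 25))
         (Map 32 10 (Var 0) (Get 30 (Var 10)))))
    Skip.

Definition Search : cmd := For 21 (Add (Var 0) (Var 0)) (Seq Power Keep).

(* 34: the squared norm of u = v + r e_0, which replaces v in 32, where |r| is the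
   integer square root of v.v and r has the sign of v_0; 4: the vector (u.u) e_0 - 2 u_0 u, of norm u.u; 35: its quadratic form. *)
Definition Finish : cmd :=
  Seq (Isqrt (Var 27))
  (Seq (If (Var 32) (Assign 32 (Cst 0) (Add (Var 32) (Var 13)))
                    (Assign 32 (Cst 0) (Sub (Var 32) (Var 13))))
  (Seq (Sum 34 10 (Var 0) (Mul (Get 32 (Var 10)) (Get 32 (Var 10))))
  (Seq (Map 4 10 (Var 0) (Mul (Mul (Cst (- 2%:Z)) (Var 32)) (Get 32 (Var 10))))
  (Seq (Assign 4 (Cst 0) (Add (Var 4) (Var 34)))
  (Seq (Map 5 10 (Var 0) (Var 34))
  (Seq (MatVec 31 4 (Cst 1) (Cst 0))
  (Seq (Sum 35 10 (Var 0) (Mul (Get 4 (Var 10)) (Get 31 (Var 10))))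
  (Seq (Assign 3 (Cst 1) (Var 35))
  (Seq (Assign 3 (Cst 2) (Mul (Var 34) (Var 34)))
       (If (Sub (Add (Mul (Cst 4) (Mul (Mul (Var 35) (Var 35))
                                       (Mul (Get 2 (Cst 1)) (Get 2 (Cst 1)))))
                     (Cst 1))
                (Mul (Mul (Get 2 (Cst 0)) (Get 2 (Cst 0)))
                     (Mul (Var 19) (Mul (Mul (Var 34) (Var 34))
                                        (Mul (Var 34) (Var 34))))))
          (Assign 3 (Cst 0) (Cst 1)) Skip)))))))))).

Definition Eigen : cmd := Seq Setup (Seq Search Finish).

Lemma absz_add_le (x y : int) : (`|(x + y)%R| <= `|x| + `|y|)%N.
Proof. by lia. Qed.

Lemma absz_root_le (r F : int) : 0 <= r -> r ^+ 2 <= F -> (`|r| <= `|F|)%N.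
Proof. by rewrite expr2; nia. Qed.

(** * Search and rounding in integer arithmetic *)

Section Program.

Variables (W n : nat) (a : nat -> nat -> int) (BA : nat).
Hypotheses (n_gt0 : (0 < n)%N) (BA_gt0 : (0 < BA)%N)
  (a_le : forall i j, (i < n)%N -> (j < n)%N -> (`|a i j| <= BA)%N).

Definition holds_matrix (s : store) :=
  s 0%N 0 = n%:Z /\
  forall i j, (i < n)%N -> (j < n)%N -> s 1%N (i * n + j)%N%:Z = a i j.

Definition frob2 : int := \sum_(0 <= i < n) \sum_(0 <= j < n) a i j * a i j.

Lemma absz_frob2_le : (`|frob2| <= n * n * (BA * BA))%N.
Proof.
rewrite -mulnA; apply: absz_sum_le => i i_n; apply: absz_sum_le => j j_n.
by rewrite abszM leq_mul ?a_le.
Qed.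

Variables (c : int) (K N0 : nat).
Hypotheses (K_gt0 : (0 < K)%N) (c_ge1 : 1 <= c).

Definition step (sg : int) (x : nat -> int) (i : nat) : int :=
  c * x i + sg * \sum_(0 <= j < n) a i j * x j.

Definition start (i0 i : nat) : int := if i == i0 then K%:Z else 0.

(** Positive signs are numbered first: as only strict improvements replace the current best, a
    winner of sign -1 strictly beats all of them. *)
Definition sgt (t : nat) : int := if (t < n)%N then 1 else -1.
Definition omt (t : nat) : int := if (t < n)%N then n%:Z else 1.
Definition idt (t : nat) : nat := if (t < n)%N then t else (t - n)%N.

Definition cand (t : nat) : nat -> int := iter (2 * N0) (step (sgt t)) (start (idt t)).
Definition sqn (x : nat -> int) : int := \sum_(0 <= i < n) x i * x i.

Let G := (`|c| + n * BA)%N.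
Definition vbound := (K * G ^ (2 * N0))%N.
(** A common base for sizes: stored numbers are bounded by powers [qbound ^ e] with [e < 30].
    Products add exponents, and a sum of two costs one more since [qbound >= 2]. *)
Definition qbound := (2 * n * BA * vbound)%N.

Lemma sqn_ge0 x : 0 <= sqn x.
Proof. by apply: sumr_ge0 => i _; rewrite -expr2 sqr_ge0. Qed.

Lemma step_le sg x B k : (`|sg| <= 1)%N -> (forall i, (i < n)%N -> (`|x i| <= B)%N) ->
  (k < n)%N -> (`|step sg x k| <= B * G)%N.
Proof.
move=> sg1 xB kn; rewrite /G mulnDr mulnC (mulnC B) -mulnA.
apply: absz_matvec_le => // [|j jn]; first exact: xB.
by rewrite abszM leq_mul ?a_le ?xB.
Qed.

Lemma iter_step_le sg i0 k i : (`|sg| <= 1)%N -> (i < n)%N ->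
  (`|iter k (step sg) (start i0) i| <= K * G ^ k)%N.
Proof.
move=> sg1; elim: k i => [|k IH] i i_n.
  by rewrite /= muln1 /start; case: ifP.
by rewrite iterS expnSr mulnA; exact: step_le.
Qed.

Lemma G_gt0 : (0 < G)%N.
Proof. by rewrite /G; lia. Qed.

Lemma iter_step_le_vbound sg i0 k i : (`|sg| <= 1)%N -> (i < n)%N ->
  (k <= 2 * N0)%N ->
  (`|iter k (step sg) (start i0) i| <= vbound)%N.
Proof.
move=> sg1 i_n kN; apply: leq_trans (iter_step_le _ _ _ _) _ => //.
by rewrite leq_mul2l leq_pexp2l ?G_gt0 ?orbT.
Qed.

Lemma vbound_gt0 : (0 < vbound)%N.
Proof. by rewrite /vbound muln_gt0 K_gt0 expn_gt0 G_gt0. Qed.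

Lemma sgt_le1 t : (`|sgt t| <= 1)%N.
Proof. by rewrite /sgt; case: ifP. Qed.

Hypotheses (nW : (n * n <= W)%N) (n2W : (n + n <= W)%N) (NW : (N0 <= W)%N).
Hypothesis QW : (qbound ^ 30 <= 2 ^ W)%N.

Lemma ltn_qbound (X e : nat) : (X <= qbound ^ e)%N -> (e < 30)%N -> (X < 2 ^ W)%N.
Proof.
move=> Xe e30; apply: leq_ltn_trans Xe _; apply: leq_trans QW.
rewrite ltn_exp2l //; have := vbound_gt0; rewrite /qbound.
rewrite -(ltn_pmul2l BA_gt0) -(ltn_pmul2l n_gt0); lia.
Qed.

Lemma qbound_ge2 : (2 <= qbound)%N.
Proof.
rewrite /qbound -!mulnA -[leqLHS]muln1 leq_mul2l /=.
by rewrite 2!muln_gt0 n_gt0 BA_gt0 vbound_gt0.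
Qed.

Lemma qboundM X Y e f : (X <= qbound ^ e)%N -> (Y <= qbound ^ f)%N ->
  (X * Y <= qbound ^ (e + f))%N.
Proof. by move=> h1 h2; rewrite expnD leq_mul. Qed.

Lemma qboundD X Y e : (X <= qbound ^ e)%N -> (Y <= qbound ^ e)%N ->
  (X + Y <= qbound ^ e.+1)%N.
Proof.
move=> h1 h2; rewrite expnS; apply: leq_trans (leq_mul qbound_ge2 (leqnn _)).
by rewrite mul2n -addnn leq_add.
Qed.

Lemma qboundW X e f : (X <= qbound ^ e)%N -> (e <= f)%N -> (X <= qbound ^ f)%N.
Proof.
move=> h ef; apply: leq_trans h _; rewrite leq_pexp2l //.
exact: ltnW qbound_ge2.
Qed.

Lemma qbound1 : (1 <= qbound ^ 0)%N.
Proof. by []. Qed.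

Lemma qbound_n : (n <= qbound ^ 1)%N.
Proof.
rewrite expn1 /qbound; move: vbound vbound_gt0 => V V0.
by rewrite -!mulnA mulnCA leq_pmulr // !muln_gt0 BA_gt0 V0.
Qed.

Lemma qbound_BA : (BA <= qbound ^ 1)%N.
Proof.
rewrite expn1 /qbound; move: vbound vbound_gt0 => V V0.
by rewrite mulnAC leq_pmull // !muln_gt0 n_gt0 V0.
Qed.

Lemma qbound_v : (vbound <= qbound ^ 1)%N.
Proof. by rewrite expn1 /qbound leq_pmull // !muln_gt0 n_gt0 BA_gt0. Qed.

Lemma cand_le t i : (i < n)%N -> (`|cand t i| <= vbound)%N.
Proof. by move=> i_n; apply: iter_step_le_vbound; rewrite ?sgt_le1. Qed.

Lemma sqn_le t : (`|sqn (cand t)| <= n * (vbound * vbound))%N.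
Proof.
by apply: absz_sum_le => i i_n; rewrite abszM leq_mul ?cand_le.
Qed.

(** Products alternate between arrays 30 and 31, since [MatVec] cannot overwrite its source; one
    pass makes two steps, whence [2 * N0]. *)
Lemma wp_power s t : holds_matrix s -> s 17%N 0 = K%:Z -> s 18%N 0 = N0%:Z ->
  s 20%N 0 = c -> s 21%N 0 = t%:Z -> (t < n + n)%N -> (`|c| <= vbound)%N ->
  wp W Power s (fun s' =>
    [/\ s' 23%N 0 = omt t, forall i, (i < n)%N -> s' 30%N i%:Z = cand t i
      & s' 25%N 0 = sqn (cand t)]).
Proof.
move=> [s0 s1] s17 s18 s20 s21 tn cV.
have n_lt : (n < 2 ^ W)%N by exact: ltn_qbound qbound_n _.
have K_lt : (K < 2 ^ W)%N.
  by apply: ltn_qbound (leq_trans _ qbound_v) _ => //; rewrite leq_pmulr // expn_gt0 G_gt0.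
have one_lt : (1 < 2 ^ W)%N by exact: ltn_qbound (qboundW qbound1 _) (_ : 1 < 30)%N.
have n_le : (n <= W)%N by lia.
apply: wp_seq.
apply: (@wp_frame _ _ _ (fun s' => [/\ s' 22%N 0 = sgt t, s' 23%N 0 = omt t
    & s' 24%N 0 = (idt t)%:Z])).
  rewrite /wp /update /= s0 s21 subr_gt0 ltz_nat /sgt /omt /idt; case: ltnP => tn'.
    by do 3!(split; first by lia).
  by do 3!(split; first by lia); split=> //; lia.
move=> s2 [s22 s23 s24] /= ag2.
have id_n : (idt t < n)%N by rewrite /idt; case: ifP => //; lia.
apply: wp_seq; apply: (wp_map (m := n) (f := fun=> 0)) => //.
- by move=> s' ag; rewrite /= ag // ag2.
- by rewrite expn_gt0.
move=> s3 ag3 z3.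
apply/wp_seq/(wp_assign (v := K%:Z) (k := (idt t)%:Z)) => //=.
- by rewrite ag3 // ag2.
- by rewrite ag3.
set s4 := update _ _ _ _.
have ag4 : agree [:: 10; 22; 23; 24; 30]%N s s4.
  apply: (@agree_trans _ _ s2); first by apply: agree_sub ag2; apply/allP.
  apply: (@agree_trans _ _ s3); first by apply: agree_sub ag3; apply/allP.
  exact: agree_update.
have v4 i : (i < n)%N -> s4 30%N i%:Z = start (idt t) i.
  move=> i_n; rewrite /start /s4; case: eqP => [->|/eqP ii]; first by rewrite updateE.
  by rewrite updateNi ?z3 // eqz_nat.
have s422 : s4 22%N 0 = sgt t by rewrite /s4 updateN // ag3.
have s423 : s4 23%N 0 = omt t by rewrite /s4 updateN // ag3.
apply: wp_seq.
pose x k := iter (2 * k) (step (sgt t)) (start (idt t)).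
have stepB B : (B <= vbound)%N -> (`|c| * B + n * (BA * B) < 2 ^ W)%N.
  move=> BV; apply: (@ltn_qbound _ 5) => //; apply: qboundD.
    by apply: (qboundW (qboundM (leq_trans cV qbound_v) (leq_trans BV qbound_v))).
  by apply: (qboundW (qboundM qbound_n (qboundM qbound_BA (leq_trans BV qbound_v)))).
apply: (wp_for (m := N0)
  (I := fun k s' => forall i, (i < n)%N -> s' 30%N i%:Z = x k i)) => //.
- by move=> s' ag; rewrite /= ag // ag4.
- move=> k s5 kN ag5 _ Ik.
  have sA5 i j : (i < n)%N -> (j < n)%N -> s5 1%N (i * n + j)%N = a i j.
    by move=> i_n j_n; rewrite ag5 // ag4 // s1.
  apply: wp_seq; apply: (wp_matvec (n := n) (sg := sgt t) (c := c) (a := a)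
    (x := x k) (BA := BA) (BX := vbound)) => //.
  + by move=> s' ag; rewrite /= ag // ag5.
  + by move=> s' ag; rewrite /= ag // ag5 // ag4.
  + by rewrite ag5 // ag4.
  + by move=> i i_n; apply: iter_step_le_vbound; rewrite ?sgt_le1 //; lia.
  + exact: sgt_le1.
  + exact: stepB.
  move=> s6 ag6 x6.
  apply: (wp_matvec (n := n) (sg := sgt t) (c := c) (a := a)
    (x := step (sgt t) (x k)) (BA := BA) (BX := vbound)) => //.
  + by move=> s' ag; rewrite /= ag // ag6 // ag5.
  + by move=> s' ag; rewrite /= ag // ag6 // ag5 // ag4.
  + by rewrite ag6 // ag5 // ag4.
  + by move=> i j i_n j_n; rewrite ag6 // sA5.
  + by move=> i i_n; rewrite -iterS; apply: iter_step_le_vbound; rewrite ?sgt_le1 //; lia.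
  + exact: sgt_le1.
  + exact: stepB.
  by move=> s7 ag7 x7 i i_n; rewrite x7 // /x mulnS !iterS.
move=> s8 ag8 x8.
apply: (wp_sum (m := n) (f := fun i => cand t i * cand t i) (B := (vbound * vbound)%N)) => //.
- by move=> s' ag; rewrite /= ag // ag8 // ag4.
- by move=> k s' kn ag xk; rewrite /= xk ag // x8.
- by move=> k kn; rewrite abszM leq_mul ?cand_le.
- exact: ltn_qbound (qboundM qbound_n (qboundM qbound_v qbound_v)) _.
move=> s9 ag9 S9; split=> //; first by rewrite ag9 // ag8.
by move=> i i_n; rewrite ag9 // x8.
Qed.

Definition wt t := omt t * sqn (cand t).

Lemma wt_ge0 t : 0 <= wt t.
Proof. by rewrite mulr_ge0 ?sqn_ge0 // /omt; case: ifP. Qed.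

Lemma wt_le t : (`|wt t| <= qbound ^ 4)%N.
Proof.
rewrite /wt abszM; apply: (@qboundM _ _ 1 3); last first.
  by apply: leq_trans (sqn_le t) _; exact: qboundM qbound_n (qboundM qbound_v qbound_v).
by rewrite /omt; case: ifP => _; [exact: qbound_n | exact: qboundW qbound1 _].
Qed.

Definition first_best t t0 := [/\ (t0 < t)%N, forall t', (t' < t)%N -> wt t' <= wt t0
  & forall t', (t' < t0)%N -> wt t' < wt t0].

(** The initial value -1 lies below every weight, so the first candidate is always kept. *)
Definition best_inv t (s : store) :=
  t = 0%N /\ s 26%N 0 = - 1 \/
  exists2 t0, first_best t t0 &
    [/\ s 26%N 0 = wt t0, s 27%N 0 = sqn (cand t0)
      & forall i, (i < n)%N -> s 32%N i%:Z = cand t0 i].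

Lemma wp_keep s t : s 0%N 0 = n%:Z -> s 23%N 0 = omt t ->
  (forall i, (i < n)%N -> s 30%N i%:Z = cand t i) -> s 25%N 0 = sqn (cand t) ->
  best_inv t s -> wp W Keep s (best_inv t.+1).
Proof.
move=> s0 s23 s30 s25 inv; rewrite /Keep.
have fb t0 : first_best t t0 -> wt t <= wt t0 -> first_best t.+1 t0.
  move=> [t0t le_t lt_t] h; split=> //; first by lia.
  by move=> t'; rewrite ltnS leq_eqVlt => /orP[/eqP->|/le_t].
have fbS : (forall t', (t' < t)%N -> wt t' < wt t) -> first_best t.+1 t.
  move=> h; split=> // t'; rewrite ltnS leq_eqVlt => /orP[/eqP->//|/h/ltW//].
apply: wp_if; rewrite /= s23 s25 -/(wt t) => test; last first.
  case: inv => [[-> s26]|[t0 t0fb [s26 s27 s32]]].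
    by move: test; rewrite s26; have := wt_ge0 t; lia.
  by right; exists t0 => //; apply: fb => //; move: test; rewrite s26; lia.
apply/wp_seq/(wp_assign (v := wt t) (k := 0)) => //=; first by rewrite s23 s25.
  exact: ltn_qbound (wt_le t) _.
apply/wp_seq/(wp_assign (v := sqn (cand t)) (k := 0)) => //=.
  apply: ltn_qbound (leq_trans (sqn_le t) (qboundM qbound_n (qboundM qbound_v qbound_v))) _ => //.
set s1 := update (update _ _ _ _) _ _ _.
apply: (wp_map (m := n) (f := cand t)) => //.
- by lia.
- by move=> s' ag; rewrite /= ag.
- by move=> k s' kn ag xk; rewrite /= xk ag // /s1 !updateN // s30.
- by move=> k kn; apply: ltn_qbound (leq_trans (cand_le t kn) qbound_v) _.
move=> s2 ag2 s32; right; exists t; last by split=> //; rewrite ag2.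
apply: fbS => t' t't; case: inv => [[t0 _]|[t0 [_ le_t _] [s26 _ _]]].
  by rewrite t0 in t't.
by move: test; rewrite s26; have := le_t _ t't; lia.
Qed.

Lemma wp_search s : holds_matrix s -> s 17%N 0 = K%:Z -> s 18%N 0 = N0%:Z ->
  s 20%N 0 = c -> s 26%N 0 = - 1 -> (`|c| <= vbound)%N ->
  wp W Search s (best_inv (n + n)).
Proof.
move=> hm s17 s18 s20 s26 cV; have [s0 s1] := hm.
apply: (wp_for (m := (n + n)%N) (I := best_inv)) => //.
- by move=> s' ag; rewrite /= ag // s0 -PoszD.
- by left.
move=> t s' tn ag st inv; apply: wp_seq.
have hm' : holds_matrix s' by split=> [|i j i_n j_n]; rewrite ag // s1.
apply: (wp_frame (wp_power hm' _ _ _ st tn cV)); try by rewrite ag.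
move=> s2 [h23 h30 h25] ag2; apply: wp_keep => //.
  by rewrite ag2 // ag.
case: inv => [[t0 h26]|[t0 fb [h26 h27 h32]]]; first by left; rewrite ag2.
right; exists t0 => //; rewrite !ag2 //; split=> // i i_n.
by rewrite ag2 // h32.
Qed.

Definition refl_u (x : nat -> int) (rho : int) (i : nat) : int :=
  x i + (if i == 0%N then rho else 0).

Definition refl_z (u : nat -> int) (i : nat) : int :=
  - 2%:Z * u 0%N * u i + (if i == 0%N then sqn u else 0).

Definition qform (z : nat -> int) : int :=
  \sum_(0 <= i < n) z i * \sum_(0 <= j < n) a i j * z j.

(** With [eps = p / q] and [th = g / (sqn u)^2], the flag is the test [eps^2 |A|_F^2 <= 4 th^2] with
    denominators cleared; the [+ 1] turns a weak integer inequality into strict positivity. *)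
Definition finish_post (x : nat -> int) (p q : int) (s : store) :=
  exists r : int, [/\ 0 <= r, r ^+ 2 <= sqn x, sqn x < (r + 1) ^+ 2 &
    let u := refl_u x (if 0 < x 0%N then r else - r) in
    let g := qform (refl_z u) in
    [/\ forall i, (i < n)%N -> s 4%N i%:Z = refl_z u i,
        forall i, (i < n)%N -> s 5%N i%:Z = sqn u,
        s 3%N 1 = g, s 3%N 2%:Z = sqn u * sqn u &
        s 3%N 0 = if 0 < 4%:Z * (g * g * (q * q)) + 1 -
          p * p * (frob2 * (sqn u * sqn u * (sqn u * sqn u))) then 1 else 0]].

(** Exponents of [qbound] along the way: 4 for [u], 9 for its squared norm, 10 for [z], 12 for its
    image under the matrix, 23 for the quadratic form. *)
Lemma wp_finish s t p q : holds_matrix s -> s 27%N 0 = sqn (cand t) ->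
  (forall i, (i < n)%N -> s 32%N i%:Z = cand t i) -> s 19%N 0 = frob2 ->
  s 3%N 0 = 0 -> s 2%N 0 = p -> s 2%N 1 = q ->
  wp W Finish s (finish_post (cand t) p q).
Proof.
move=> [s0 s1] s27 s32 s19 s30 sp sq; set x := cand t.
have n_le : (n <= W)%N by lia.
have xB i : (i < n)%N -> (`|x i| <= qbound ^ 1)%N.
  by move=> i_n; apply: leq_trans (cand_le t i_n) qbound_v.
have SB : (`|sqn x| <= qbound ^ 3)%N.
  exact: leq_trans (sqn_le t) (qboundM qbound_n (qboundM qbound_v qbound_v)).
have S0 : 0 <= sqn x by exact: sqn_ge0.
apply/wp_seq/(wp_isqrt S0).
- by apply: ltn_qbound (qboundD SB (qboundW qbound1 _)) _.
- by move=> s' ag; rewrite /= ag.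
move=> s2 r ag2 s2r r0 rS Sr.
have rB : (`|r| <= qbound ^ 3)%N.
  exact: leq_trans (absz_root_le r0 rS) SB.
pose u := refl_u x (if 0 < x 0%N then r else - r).
have uB i : (i < n)%N -> (`|u i| <= qbound ^ 4)%N.
  move=> i_n; have h1 := qboundD (qboundW (xB i i_n) (isT : 1 <= 3)%N) rB.
  apply: leq_trans h1; rewrite /u /refl_u.
  by case: (i == 0%N); case: (0 < x 0%N); lia.
have s2x i : (i < n)%N -> s2 32%N i%:Z = x i by move=> i_n; rewrite ag2 // s32.
apply: wp_seq.
apply: (@wp_frame _ _ _ (fun s' => forall i, (i < n)%N -> s' 32%N i%:Z = u i)).
  have upd v : v = u 0%N -> forall i, (i < n)%N -> update s2 32 0 v 32%N i%:Z = u i.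
    move=> -> i i_n; have [->|i0] := eqVneq i 0%N; first by rewrite updateE.
    by rewrite updateNi // s2x // /u /refl_u (negbTE i0) addr0.
  have u0_lt := ltn_qbound (uB _ n_gt0) isT.
  apply: wp_if; rewrite /= s2x // => test.
    apply: (wp_assign (v := u 0%N) (k := 0)) => //=; last exact: upd.
    by rewrite s2x // s2r /u /refl_u eqxx test.
  apply: (wp_assign (v := u 0%N) (k := 0)) => //=; last exact: upd.
  by rewrite s2x // s2r /u /refl_u eqxx ltNge test.
move=> s3 s3u /= ag3.
have uuB : (`|sqn u| <= qbound ^ 9)%N.
  apply: leq_trans (absz_sum_le _) (qboundM qbound_n (leqnn (qbound ^ 8))).
  by move=> i i_n; rewrite abszM; apply: (qboundM (uB i i_n) (uB i i_n)).
apply/wp_seq/(wp_sum (m := n) (f := fun i => u i * u i) (B := (qbound ^ 8)%N)) => //.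
- by move=> s' ag; rewrite /= ag // ag3 // ag2.
- by move=> k s' kn ag xk; rewrite /= xk ag // s3u.
- by move=> k kn; rewrite abszM; apply: (qboundM (uB k kn) (uB k kn)).
- exact: ltn_qbound (qboundM qbound_n (leqnn (qbound ^ 8))) _.
move=> s4 ag4 s4uu.
have two_le : (2 <= qbound ^ 1)%N by rewrite expn1 qbound_ge2.
have y_le k : (k < n)%N -> (`|(- 2%:Z * u 0%N * u k)%R| <= qbound ^ 9)%N.
  move=> kn; rewrite !abszM.
  exact: (qboundM (qboundM two_le (uB _ n_gt0)) (uB k kn)).
apply/wp_seq/(wp_map (m := n) (f := fun i => - 2%:Z * u 0%N * u i)) => //.
- by move=> s' ag; rewrite /= ag // ag4 // ag3 // ag2.
- by move=> k s' kn ag xk; rewrite /= xk !ag // !ag4 // !s3u.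
- by move=> k kn; apply: ltn_qbound (y_le k kn) _.
move=> s5 ag5 s5y.
pose z := refl_z u.
have zB k : (k < n)%N -> (`|z k| <= qbound ^ 10)%N.
  move=> kn; apply: leq_trans (qboundD (y_le k kn) uuB); rewrite /z /refl_z.
  by case: ifP => _; [exact: absz_add_le | rewrite addr0 leq_addr].
apply/wp_seq/(wp_assign (v := z 0%N) (k := 0)) => //=.
- by rewrite s5y // ag5 // s4uu /z /refl_z eqxx.
- exact: ltn_qbound (zB _ n_gt0) _.
set s6 := update _ _ _ _.
have s6z i : (i < n)%N -> s6 4%N i%:Z = z i.
  move=> i_n; rewrite /s6; have [->|i0] := eqVneq i 0%N; first by rewrite updateE.
  by rewrite updateNi // s5y // /z /refl_z (negbTE i0) addr0.
have ag6 : agree [:: 4; 10; 13; 14; 15; 32; 34]%N s s6.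
  apply: (@agree_trans _ _ s2); first by apply: agree_sub ag2; apply/allP.
  apply: (@agree_trans _ _ s3); first by apply: agree_sub ag3; apply/allP.
  apply: (@agree_trans _ _ s4); first by apply: agree_sub ag4; apply/allP.
  apply: (@agree_trans _ _ s5); first by apply: agree_sub ag5; apply/allP.
  exact: agree_update.
have s6uu : s6 34%N 0 = sqn u by rewrite /s6 updateN // ag5.
apply/wp_seq/(wp_map (m := n) (f := fun=> sqn u)) => //.
- by move=> s' ag; rewrite /= ag // ag6.
- by move=> k s' kn ag xk; rewrite /= ag.
- by move=> _ _; apply: ltn_qbound uuB _.
move=> s7 ag7 s75.
pose y i := 0 * z i + 1 * \sum_(0 <= j < n) a i j * z j.
apply/wp_seq/(wp_matvec (n := n) (sg := 1) (c := 0) (a := a) (x := z) (BA := BA)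
  (BX := (qbound ^ 10)%N)) => //.
- by rewrite ag7 // ag6.
- by move=> i j i_n j_n; rewrite ag7 // ag6 // s1.
- by move=> i i_n; rewrite ag7 // s6z.
- exact: ltn_qbound (qboundM qbound_n (qboundM qbound_BA (leqnn _))) _.
move=> s8 ag8 s8y.
have yB i : (i < n)%N -> (`|y i| <= qbound ^ 12)%N.
  move=> i_n; apply: leq_trans (qboundM qbound_n (qboundM qbound_BA (leqnn (qbound ^ 10)))).
  rewrite -[leqRHS]add0n -[X in (_ <= X + _)%N](mul0n (qbound ^ 10)%N).
  apply: (@absz_matvec_le n 0 1 (z i)) => //; first exact: zB.
  by move=> j jn; rewrite abszM leq_mul ?a_le ?zB.
have gE : \sum_(0 <= i < n) z i * y i = qform z.
  by apply: eq_bigr => i _; rewrite /y mul0r add0r mul1r.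
have zyB k : (k < n)%N -> (`|(z k * y k)%R| <= qbound ^ 22)%N.
  by move=> kn; rewrite abszM; exact: (qboundM (zB k kn) (yB k kn)).
apply/wp_seq/(wp_sum (m := n) (f := fun i => z i * y i) (B := (qbound ^ 22)%N)) => //.
- by move=> s' ag; rewrite /= ag // ag8 // ag7 // ag6.
- by move=> k s' kn ag xk; rewrite /= xk !ag // s8y // ag8 // ag7 // s6z.
- exact: ltn_qbound (qboundM qbound_n (leqnn (qbound ^ 22))) _.
move=> s9 ag9 s9g; rewrite gE in s9g.
have s9uu : s9 34%N 0 = sqn u by rewrite ag9 // ag8 // ag7.
have gB : (`|qform z| <= qbound ^ 23)%N.
  rewrite -gE; apply: leq_trans (absz_sum_le zyB) _.
  exact: qboundM qbound_n (leqnn (qbound ^ 22)).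
apply/wp_seq/(wp_assign (v := qform z) (k := 1)) => //=.
  exact: ltn_qbound gB _.
apply/wp_seq/(wp_assign (v := sqn u * sqn u) (k := 2%:Z)) => //=.
- by rewrite updateN // s9uu.
- by rewrite abszM; apply: ltn_qbound (qboundM uuB uuB) _.
set s10 := update _ 3 2 _.
have s10s : agree [:: 3; 4; 5; 10; 11; 12; 13; 14; 15; 31; 32; 34; 35]%N s s10.
  apply: (@agree_trans _ _ s6); first by apply: agree_sub ag6; apply/allP.
  apply: (@agree_trans _ _ s7); first by apply: agree_sub ag7; apply/allP.
  apply: (@agree_trans _ _ s8); first by apply: agree_sub ag8; apply/allP.
  apply: (@agree_trans _ _ s9); first by apply: agree_sub ag9; apply/allP.
  by apply: (@agree_trans _ _ (update s9 3 1 (qform z))); exact: agree_update.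
have s10g : s10 35%N 0 = qform z by rewrite /s10 !updateN.
have s10uu : s10 34%N 0 = sqn u by rewrite /s10 !updateN.
have post11 s11 : agree [:: 3]%N s10 s11 -> s11 3%N 1 = qform z ->
    s11 3%N 2%:Z = sqn u * sqn u ->
    s11 3%N 0 = (if 0 < 4%:Z * (qform z * qform z * (q * q)) + 1 -
      p * p * (frob2 * (sqn u * sqn u * (sqn u * sqn u))) then 1 else 0) ->
    finish_post x p q s11.
  move=> ag11 h1 h2 h3; exists r; split=> //; rewrite -/u -/z; split=> //.
    by move=> i i_n; rewrite ag11 // /s10 !updateN // ag9 // ag8 // ag7 // s6z.
  by move=> i i_n; rewrite ag11 // /s10 !updateN // ag9 // ag8 // s75.
(* The large operands of the test are evaluated but never stored, so no size bound is due here. *)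
apply: wp_if; rewrite /= s10g s10uu !(s10s 2%N) // sp sq (s10s 19%N) // s19 => test.
  apply: (wp_assign (v := 1) (k := 0)) => //=.
    by apply: ltn_qbound (qboundW qbound1 _) (_ : 1 < 30)%N.
  by apply: post11 => //; rewrite ?test //; exact: agree_update.
have s10f : s10 3%N 0 = 0.
  by rewrite /s10 !updateNi // ag9 // ag8 // ag7 // ag6.
by apply: post11 => //; rewrite s10f ltNge test.
Qed.

End Program.

(** * The composed program and an a priori size bound *)

Section WholeProgram.

Variables (W n : nat) (a : nat -> nat -> int) (BA H : nat).
Hypotheses (n_gt0 : (0 < n)%N) (BA_gt0 : (0 < BA)%N) (H_gt0 : (0 < H)%N)
  (a_le : forall i j, (i < n)%N -> (j < n)%N -> (`|a i j| <= BA)%N).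

Let K := (12 * (n * H))%N.
Let N0 := (128 * (n * (n * n) * (H * H)))%N.

(** [qbound] with [|c|] replaced by an upper bound that depends only on [n] and [BA], so that [W]
    can be fixed before the run. *)
Definition sbound := (2 * n * BA * (K * (n * n * (BA * BA) + 1 + n * BA) ^ (2 * N0)))%N.

Hypotheses (nW : (n * n <= W)%N) (n2W : (n + n <= W)%N) (NW : (N0 <= W)%N).
Hypothesis QW : (sbound ^ 30 <= 2 ^ W)%N.

Let K_gt0 : (0 < K)%N.
Proof. by rewrite !muln_gt0 n_gt0 H_gt0. Qed.

Let N0_gt0 : (0 < N0)%N.
Proof. by rewrite !muln_gt0 n_gt0 H_gt0. Qed.

Lemma setup_bounds : [/\ (1 < 2 ^ W)%N, (H < 2 ^ W)%N, (K < 2 ^ W)%N, (N0 < 2 ^ W)%N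
  & (n * n * (BA * BA) + 1 < 2 ^ W)%N].
Proof.
have G2 : (1 <= n * n * (BA * BA) + 1 + n * BA)%N by rewrite addn1.
have GN : (n * n * (BA * BA) + 1 + n * BA <=
    (n * n * (BA * BA) + 1 + n * BA) ^ (2 * N0))%N.
  by rewrite -{1}[X in (X <= _)%N]expn1 leq_pexp2l // muln_gt0 N0_gt0.
have KN : (K <= sbound)%N.
  rewrite /sbound mulnCA leq_pmulr // !muln_gt0 n_gt0 BA_gt0 expn_gt0.
  by rewrite addn1.
have s2 : (2 <= sbound)%N.
  by apply: leq_trans KN; rewrite (@leq_trans 12) // leq_pmulr // muln_gt0 n_gt0.
have lt x : (x <= sbound)%N -> (x < 2 ^ W)%N.
  move=> xs; apply: leq_ltn_trans xs _; apply: leq_trans QW.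
  by rewrite -{1}(expn1 sbound) ltn_exp2l.
split; [apply: lt | apply: lt | exact: lt | | apply: lt].
- exact: ltnW.
- by apply: leq_trans KN; rewrite /K mulnA leq_pmull // muln_gt0 n_gt0.
- by apply: leq_ltn_trans NW _; exact: ltn_expl.
- apply: leq_trans (_ : (n * n * (BA * BA) + 1 + n * BA <= _)%N); first exact: leq_addr.
  apply: leq_trans GN _; rewrite /sbound [leqRHS]mulnA leq_pmull //.
  by rewrite !muln_gt0 n_gt0 BA_gt0.
Qed.

Lemma big_square_nat (f : nat -> int) :
  \sum_(0 <= k < n * n) f k = \sum_(0 <= i < n) \sum_(0 <= j < n) f (i * n + j)%N.
Proof.
rewrite big_nat_mul; apply: eq_bigr => i _.
rewrite -{1}[(i * n)%N]add0n mulSn big_addn addnK.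
by apply: eq_bigr => j _; rewrite addnC.
Qed.

Lemma wp_setup s : holds_matrix n a s ->
  (s 2%N 3%:Z %/ s 2%N 2%:Z)%Z + 1 = H%:Z ->
  wp W Setup s (fun s' => s' 17%N 0 = K%:Z /\ s' 18%N 0 = N0%:Z /\
    s' 19%N 0 = frob2 n a /\ s' 26%N 0 = - 1 /\
    exists c, [/\ s' 20%N 0 = c, 1 <= c, frob2 n a < c ^+ 2 & (c - 1) ^+ 2 <= frob2 n a]).
Proof.
move=> [s0 s1] sH; have [W1 HW KW N0W FW] := setup_bounds.
apply/wp_seq/(wp_assign (v := H%:Z) (k := 0)) => //=.
apply/wp_seq/(wp_assign (v := K%:Z) (k := 0)) => //=.
  by rewrite updateN // updateE s0 -!PoszM.
apply/wp_seq/(wp_assign (v := N0%:Z) (k := 0)) => //=.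
  by rewrite /update /= s0 -!PoszM.
set s2 := update _ 18 _ _.
have ag2 : agree [:: 16; 17; 18]%N s s2.
  apply: (@agree_trans _ _ (update s 16 0 H%:Z)); first exact: agree_update.
  apply: (@agree_trans _ _ (update (update s 16 0 H%:Z) 17 0 K%:Z)); exact: agree_update.
have aE k : (k < n * n)%N -> s 1%N k%:Z = a (k %/ n) (k %% n).
  by move=> kn; rewrite -s1 ?ltn_pmod // -?divn_eq // ltn_divLR.
have aB k : (k < n * n)%N -> (`|a (k %/ n) (k %% n)| <= BA)%N.
  by move=> kn; rewrite a_le ?ltn_pmod // ltn_divLR.
apply/wp_seq/(wp_sum (m := (n * n)%N)
  (f := fun k => a (k %/ n) (k %% n) * a (k %/ n) (k %% n)) (B := (BA * BA)%N)) => //.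
- by move=> s' ag; rewrite /= !ag // ag2 // s0 -PoszM.
- by move=> k s' kn ag xk; rewrite /= xk ag // ag2 // aE.
- by move=> k kn; rewrite abszM leq_mul ?aB.
- by apply: leq_ltn_trans FW; rewrite leq_addr.
move=> s3 ag3; rewrite big_square_nat.
have -> : \sum_(0 <= i < n) \sum_(0 <= j < n)
    a ((i * n + j) %/ n)%N ((i * n + j) %% n)%N *
    a ((i * n + j) %/ n)%N ((i * n + j) %% n)%N = frob2 n a.
  apply: eq_big_nat => i i_n; apply: eq_big_nat => j /andP[_ jn].
  by rewrite divnMDl // divn_small // addn0 modnMDl modn_small.
move=> s3F; have FB := absz_frob2_le a_le.
have F0 : 0 <= frob2 n a.
  by apply: sumr_ge0 => i _; apply: sumr_ge0 => j _; rewrite -expr2 sqr_ge0.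
apply/wp_seq/(wp_isqrt F0).
- by apply: leq_ltn_trans FW; rewrite leq_add2r.
- by move=> s' ag; rewrite /= ag.
move=> s4 r ag4 s4r r0 rF Fr.
apply/wp_seq/(wp_assign (v := r + 1) (k := 0)) => //=; first by rewrite s4r.
  apply: leq_ltn_trans FW; have := leq_trans (absz_root_le r0 rF) FB.
  by move: (n * n * _)%N => X; lia.
apply: (wp_assign (v := - 1) (k := 0)) => //=.
split; first by rewrite !updateN // ag4 // ag3.
split; first by rewrite !updateN // ag4 // ag3.
split; first by rewrite !updateN // ag4.
split; first by rewrite updateE.
by exists (r + 1); split=> //; rewrite ?addrK // ler_wpDl.
Qed.

Definition eigen_post (p q : int) (s : store) :=
  exists (c : int) (t0 : nat), [/\ 1 <= c, frob2 n a < c ^+ 2,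
    (c - 1) ^+ 2 <= frob2 n a, first_best n a c K N0 (n + n) t0
    & finish_post n a (cand n a c K N0 t0) p q s].

Lemma wp_eigen s : holds_matrix n a s -> s 3%N 0 = 0 ->
  (s 2%N 3%:Z %/ s 2%N 2%:Z)%Z + 1 = H%:Z ->
  wp W Eigen s (eigen_post (s 2%N 0) (s 2%N 1)).
Proof.
move=> hm s3 sH; have [s0 s1] := hm.
apply/wp_seq/(wp_frame (wp_setup hm sH)).
move=> s2 [h17 [h18 [h19 [h26 [c [h20 c1 Fc cF]]]]]] ag2.
have hm2 : holds_matrix n a s2 by split=> [|i j i_n j_n]; rewrite ag2 // s1.
have cB : (`|c| <= n * n * (BA * BA) + 1)%N.
  have c0 : 0 <= c - 1 by rewrite subr_ge0.
  have := leq_trans (absz_root_le c0 cF) (absz_frob2_le a_le).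
  by move: (n * n * _)%N => X; lia.
have QW' : (qbound n BA c K N0 ^ 30 <= 2 ^ W)%N.
  apply: leq_trans QW; rewrite leq_exp2r // /qbound /sbound /vbound.
  apply: leq_mul => //; apply: leq_mul => //.
  by rewrite leq_exp2r ?leq_add2r // muln_gt0 N0_gt0.
have cV : (`|c| <= vbound n BA c K N0)%N.
  rewrite /vbound; apply: leq_trans (_ : (`|c| + n * BA <= _)%N); first exact: leq_addr.
  apply: leq_trans (leq_pmull _ K_gt0); rewrite -{1}[X in (X <= _)%N]expn1.
  by rewrite leq_pexp2l ?muln_gt0 ?N0_gt0 //; lia.
apply: wp_seq.
have search := wp_search n_gt0 BA_gt0 a_le K_gt0 c1 nW n2W NW QW' hm2 h17 h18 h20 h26 cV.
apply: (wp_frame search).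
(* The other alternative would mean that no candidate was examined, but [n + n] is positive. *)
move=> s4 [[n0 _]|[t0 fb [h26' h27 h32]]] ag4; first by move: n_gt0 n0; lia.
have hm4 : holds_matrix n a s4.
  by split=> [|i j i_n j_n]; rewrite ag4 // ag2 // s1.
have h19' : s4 19%N 0 = frob2 n a by rewrite ag4.
have h3' : s4 3%N 0 = 0 by rewrite ag4 // ag2.
have h20' : s4 2%N 0 = s 2%N 0 by rewrite ag4 // ag2.
have h21' : s4 2%N 1 = s 2%N 1 by rewrite ag4 // ag2.
have fin := wp_finish n_gt0 BA_gt0 a_le K_gt0 c1 nW n2W NW QW' hm4 h27 h32 h19' h3' h20' h21'.
by apply: (wp_frame fin) => s5 post _; exists c, t0.
Qed.

End WholeProgram.

(** * Correctness *)

Section IntegerVectors.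

Variables (R : realType) (n : nat) (A : 'M[int]_n).

Definition entry (i j : nat) : int :=
  match insub i, insub j with Some p, Some q => A p q | _, _ => 0 end.

Let AR : 'M[R]_n := map_mx intr A.

Definition realcv (x : nat -> int) : 'cV[R]_n := \col_i (x i)%:~R.

Lemma entryE (i j : 'I_n) : entry i j = A i j.
Proof. by rewrite /entry !valK. Qed.

Lemma entry_sum (i : 'I_n) (x : nat -> int) :
  (\sum_(0 <= j < n) entry i j * x j)%:~R = (AR *m realcv x) i 0.
Proof.
rewrite big_mkord rmorph_sum mxE; apply: eq_bigr => j _.
by rewrite !mxE entryE -intrM.
Qed.

Lemma realcv_step c sg x :
  realcv (step n entry c sg x) = (sg%:~R *: AR + c%:~R%:M) *m realcv x.
Proof.
apply/colP => i; rewrite mulmxDl -scalemxAl mul_scalar_mx mxE /step.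
by rewrite intrD !intrM entry_sum addrC !mxE.
Qed.

Lemma realcv_start K (i : 'I_n) : realcv (start K i) = K%:R *: delta_mx i 0.
Proof.
apply/colP => j; rewrite !mxE andbT /start val_eqE.
by case: eqP => _; rewrite ?mulr1 ?mulr0 // pmulrn.
Qed.

Lemma realcv_iter c sg K (i : 'I_n) k :
  realcv (iter k (step n entry c sg) (start K i)) =
  powit AR c%:~R sg%:~R k (K%:R *: delta_mx i 0).
Proof.
elim: k => [|k IH]; first exact: realcv_start.
by rewrite !iterS realcv_step IH.
Qed.

Lemma realcv_dot x : (sqn n x)%:~R = dot (realcv x) (realcv x).
Proof.
rewrite /sqn big_mkord rmorph_sum; apply: eq_bigr => i _.
by rewrite !mxE -intrM.
Qed.

Lemma realcv_frob2 : (frob2 n entry)%:~R = \sum_i \sum_j AR i j ^+ 2.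
Proof.
rewrite /frob2 big_mkord rmorph_sum; apply: eq_bigr => i _.
rewrite big_mkord rmorph_sum; apply: eq_bigr => j _.
by rewrite /= !mxE entryE intrM expr2.
Qed.

Lemma realcv_qform z : (qform n entry z)%:~R = dot (realcv z) (AR *m realcv z).
Proof.
rewrite /qform big_mkord rmorph_sum; apply: eq_bigr => i _.
by rewrite /= intrM entry_sum [realcv z i 0]mxE.
Qed.

Variables (n_gt0 : (0 < n)%N).
Let j0 : 'I_n := Ordinal n_gt0.

Lemma realcv_refl_u x rho :
  realcv (refl_u x rho) = realcv x + rho%:~R *: delta_mx j0 0.
Proof.
apply/colP => i; rewrite !mxE andbT /refl_u intrD -[i == j0]val_eqE /=.
by case: eqP => _; rewrite ?mulr1 ?mulr0.
Qed.

Lemma realcv_refl_z x rho (u := refl_u x rho) : 0 < (sqn n u)%:~R :> R ->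
  ((sqn n u)%:~R)^-1 *: realcv (refl_z n u) = householder j0 (realcv x) rho%:~R.
Proof.
move=> uu0; rewrite /householder -realcv_refl_u -/u -realcv_dot.
apply/colP => i; rewrite !mxE andbT /refl_z intrD !intrM -[i == j0]val_eqE /=.
have -> : (- 2%:Z)%:~R = - 2 :> R by rewrite mulrNz.
move: uu0; case: eqP => _ /=; rewrite ?mulr0z;
  move: ((sqn n u)%:~R : R) ((u 0%N)%:~R : R) ((u i)%:~R : R) => s y z s0;
  by field; rewrite gt_eqF.
Qed.

End IntegerVectors.

(** [H] is the floor of [1 / eta] plus one: large enough for the error bounds, small enough for a
    time polynomial in [1 / eta]. *)
Lemma inverse_upper_bound (eta : rat) : 0 < eta ->
  exists2 H : nat, (denq eta %/ numq eta)%Z + 1 = H%:Z &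
    [/\ (0 < H)%N, 1 <= H%:R * eta & H%:R <= eta^-1 + 1].
Proof.
move=> eta0; have num0 : 0 < numq eta by rewrite numq_gt0.
have den0 : 0 < denq eta by exact: denq_gt0.
have q0 : 0 <= (denq eta %/ numq eta)%Z by rewrite divz_ge0 // ltW.
exists (`|((denq eta %/ numq eta)%Z + 1)%R|)%N; first by lia.
have etaE : eta * (denq eta)%:~R = (numq eta)%:~R.
  by rewrite -[X in X * _]divq_num_den divfK // intr_eq0 denq_neq0.
have denq0 : 0 < (denq eta)%:~R :> rat by rewrite ltr0z.
have HE : (`|((denq eta %/ numq eta)%Z + 1)%R|)%N%:R =
    ((denq eta %/ numq eta)%Z + 1)%:~R :> rat.
  by rewrite -[in RHS](@gez0_abs ((denq eta %/ numq eta)%Z + 1)) //; lia.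
have := divz_eq (denq eta) (numq eta).
have := modz_ge0 (denq eta) (lt0r_neq0 num0).
have := ltz_pmod (denq eta) num0.
move: (denq eta %/ numq eta)%Z (denq eta %% numq eta)%Z q0 HE => k r q0 HE rlt r0 E.
split; first by lia.
  rewrite HE -(ler_pM2r denq0) mul1r -mulrA etaE -intrM ler_int; nia.
rewrite HE intrD lerD2r -(ler_pM2r eta0) mulVf ?gt_eqF // -(ler_pM2r denq0).
by rewrite mul1r -mulrA etaE -intrM ler_int; nia.
Qed.

Lemma sqr_succ_gt (X r : int) : X < (r + 1) ^+ 2 -> X <= r ^+ 2 + 2%:Z * r.
Proof. by rewrite !expr2; lia. Qed.

(** [c - 1] is at most the root of [F], and so is the extra unit because [F >= 1]; integrality of a
    nonzero matrix provides the latter. *)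
Lemma sqr_root_le (F c : int) : 1 <= F -> 1 <= c -> F < c ^+ 2 ->
  (c - 1) ^+ 2 <= F -> c ^+ 2 <= 4%:Z * F.
Proof. by rewrite !expr2; nia. Qed.

Lemma clear_denominators (R : realFieldType) (p q d g F : R) : 0 < q -> 0 < d ->
  ((p / q) ^+ 2 * F <= 4 * (g / (d * d)) ^+ 2) =
  (p * p * (F * (d * d * (d * d))) <= 4 * (g * g * (q * q))).
Proof.
move=> q0 d0; rewrite -(@ler_pM2r _ (q * q * (d * d * (d * d)))) ?mulr_gt0 //.
by congr (_ <= _); field; rewrite ?gt_eqF.
Qed.

Section Correctness.

Variables (R : realType) (n : nat) (A : 'M[int]_n) (eps eta : rat) (H : nat).
Hypotheses (n_gt0 : (0 < n)%N) (Asym : A^T = A) (A_neq0 : A != 0).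
Hypotheses (eps_gt0 : 0 < eps) (eta_gt0 : 0 < eta) (H_gt0 : (0 < H)%N)
  (H_eta : 1 <= H%:R * eta).

Let AR : 'M[R]_n := map_mx intr A.
Let K := (12 * (n * H))%N.
Let N0 := (128 * (n * (n * n) * (H * H)))%N.
Let a := entry A.

Lemma frob2_ge1 : 1 <= frob2 n a.
Proof.
have : frob2 n a != 0.
  rewrite -(intr_eq0 R) realcv_frob2; apply: contra A_neq0 => /eqP F0.
  have row0 i : \sum_j AR i j ^+ 2 = 0.
    apply: (psumr_eq0P _ F0) => // k _.
    by apply: sumr_ge0 => l _; exact: sqr_ge0.
  apply/eqP/matrixP => i j; apply/eqP; rewrite mxE -(intr_eq0 R).
  have : AR i j ^+ 2 = 0 by apply: (psumr_eq0P _ (row0 i)) => // k _; exact: sqr_ge0.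
  by move/eqP; rewrite sqrf_eq0 mxE.
have : 0 <= frob2 n a.
  by apply: sumr_ge0 => i _; apply: sumr_ge0 => j _; rewrite -expr2 sqr_ge0.
by move: (frob2 n a) => F; lia.
Qed.

(** Integer facts about the winning candidate are carried into [R], where they become the hypotheses
    of [selected_test] and [selected_approx]. *)
Lemma eigen_post_correct s (lam : R) : eigen_post n a H (numq eps) (denq eps) s ->
  is_lambda_max AR lam ->
  (ratr eps * frobenius_norm AR <= `|lam| -> s 3%N 0 != 0) /\
  (s 3%N 0 != 0 -> outputs_approx_eigenpair AR (ratr eps) (ratr eta) lam (read_output n s)).
Proof.
move=> [c [t0 [c1 Fc cF [t0n best strict] [r [r0 rS Sr]]]]].
set x := cand n a c K N0 t0 in rS Sr *; set rho := (if _ then _ else _).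
set u := refl_u x rho; set z := refl_z n u; move=> /= [s4 s5 s31 s32 s30] lam_max.
have F1 := frob2_ge1.
have id_n : (idt n t0 < n)%N by rewrite /idt; case: ifP => //; lia.
pose i0 : 'I_n := Ordinal id_n; pose j0 : 'I_n := Ordinal n_gt0.
pose sg : R := (sgt n t0)%:~R; pose om : R := (omt n t0)%:~R.
have ARsym : AR^T = AR by rewrite /AR map_trmx Asym.
have c_gt0 : 0 < c%:~R :> R by rewrite ltr0z; lia.
have candE t (tn : (idt n t < n)%N) : realcv R n (cand n a c K N0 t) =
    powit AR c%:~R (sgt n t)%:~R (2 * N0) (K%:R *: delta_mx (Ordinal tn) 0).
  by rewrite -realcv_iter.
have wtE t (tn : (idt n t < n)%N) : (wt n a c K N0 t)%:~R = (omt n t)%:~R *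
    dot (powit AR c%:~R (sgt n t)%:~R (2 * N0) (K%:R *: delta_mx (Ordinal tn) 0))
        (powit AR c%:~R (sgt n t)%:~R (2 * N0) (K%:R *: delta_mx (Ordinal tn) 0)).
  by rewrite /wt intrM realcv_dot candE.
have sg_om : sg = 1 /\ om = n%:R \/ sg = -1 /\ om = 1.
  by rewrite /sg /om /sgt /omt; case: ifP => _; [left | right; rewrite mulrN1z].
pose S (sg : R) (j : 'I_n) :=
  dot (powit AR c%:~R sg (2 * N0) (K%:R *: delta_mx j 0))
      (powit AR c%:~R sg (2 * N0) (K%:R *: delta_mx j 0)).
have posE (j : 'I_n) : (wt n a c K N0 j)%:~R = n%:R * S 1 j.
  have jn : (idt n j < n)%N by rewrite /idt !ltn_ord.
  rewrite (wtE _ jn) /omt /sgt ltn_ord.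
  by have -> : Ordinal jn = j by apply: val_inj; rewrite /= /idt ltn_ord.
have negE (j : 'I_n) : (wt n a c K N0 (n + j)%N)%:~R = S (-1) j.
  have nj : (n + j < n)%N = false by lia.
  have jn : (idt n (n + j) < n)%N by rewrite /idt nj addKn.
  rewrite (wtE _ jn) /omt /sgt nj mul1r mulrN1z.
  by have -> : Ordinal jn = j by apply: val_inj; rewrite /= /idt nj addKn.
have bestE : (wt n a c K N0 t0)%:~R = om * S sg i0 by rewrite (wtE _ id_n).
have sel_pos j : n%:R * S 1 j <= om * S sg i0.
  by rewrite -posE -bestE ler_int best //; have := ltn_ord j; lia.
have sel_neg j : S (-1) j <= om * S sg i0.
  by rewrite -negE -bestE ler_int best //; have := ltn_ord j; lia.
(* The tie rule enters here: all positive candidates precede a negative winner. *)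
have sel_strict : sg = -1 -> forall j, n%:R * S 1 j < S sg i0.
  rewrite /sg /sgt; case: ltnP => [_|n_t0 _ j].
    by move/eqP; rewrite mulr1z eq_sym eqNr oner_eq0.
  have := strict j (leq_trans (ltn_ord j) n_t0).
  rewrite -(ltr_int R) posE bestE; rewrite /om /omt /sg /sgt ltnNge n_t0 /=.
  by rewrite mul1r.
have H1 : 1 <= H%:R :> R by rewrite ler1n.
have F_gt0 : 0 < (frob2 n a)%:~R :> R by rewrite ltr0z; lia.
have c2_ge : (frob2 n a)%:~R <= c%:~R ^+ 2 :> R by rewrite -rmorphXn ler_int ltW.
have c2_le : c%:~R ^+ 2 <= 4 * (frob2 n a)%:~R :> R.
  have -> : 4 = 4%:Z%:~R :> R by [].
  by rewrite -rmorphXn -intrM ler_int; exact: sqr_root_le.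
have N_ge : 256 * n%:R ^+ 3 * H%:R ^+ 2 <= (2 * N0)%N%:R :> R.
  by rewrite /N0 !natrM le_eqVlt; apply/orP; left; apply/eqP; ring.
have K_gt0 : 0 < K%:R :> R by rewrite ltr0n !muln_gt0 n_gt0.
have c_ge1 : 1 <= c%:~R :> R by rewrite ler1z.
have K_ge : 12 * n%:R * H%:R <= K%:R :> R by rewrite /K !natrM mulrA.
have xE : realcv R n x = powit AR c%:~R sg (2 * N0) (K%:R *: delta_mx i0 0).
  exact: candE.
have SE : (sqn n x)%:~R = S sg i0 by rewrite realcv_dot xE.
have rho2 : rho%:~R ^+ 2 = r%:~R ^+ 2 :> R.
  by rewrite /rho; case: ifP => _ //; rewrite mulrNz sqrrN.
have m_le : rho%:~R ^+ 2 <= S sg i0 by rewrite rho2 -SE -rmorphXn ler_int.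
have m_ge : S sg i0 <= rho%:~R ^+ 2 + 2 * `|rho%:~R|.
  have -> : `|rho%:~R| = r%:~R :> R.
    by rewrite /rho; case: ifP => _; rewrite ?mulrNz ?normrN ger0_norm // ler0z.
  have -> : 2 = 2%:Z%:~R :> R by [].
  rewrite rho2 -SE -rmorphXn -intrM -intrD ler_int.
  exact: sqr_succ_gt.
have mv_ge0 : 0 <= rho%:~R * powit AR c%:~R sg (2 * N0) (K%:R *: delta_mx i0 0) j0 0.
  rewrite -xE mxE -intrM ler0z /rho /=; case: ltrP => x0.
    by rewrite mulr_ge0 // ltW.
  by rewrite mulNr oppr_ge0 mulr_ge0_le0.
have F2E : (frob2 n a)%:~R = \sum_i \sum_j AR i j ^+ 2 := realcv_frob2 R A.
pose w := householder j0 (realcv R n x) rho%:~R.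
have uu0 : 0 < (sqn n u)%:~R :> R.
  rewrite realcv_dot (realcv_refl_u R n_gt0) xE.
  apply: (householder_dot_gt0 _ mv_ge0).
  exact: (selected_gt0 ARsym lam_max n_gt0 c_gt0 sg_om sel_pos sel_neg F2E F_gt0 K_gt0).
have wE : ((sqn n u)%:~R)^-1 *: realcv R n z = w by exact: realcv_refl_z.
pose g : R := (qform n a z)%:~R; pose d : R := (sqn n u)%:~R.
have thE : g / (d * d) = dot w (AR *m w).
  rewrite -wE -scalemxAr dotZl dotZr -realcv_qform /g /d.
  by field; rewrite gt_eqF.
have test : (s 3%N 0 != 0) = (ratr eps ^+ 2 * (frob2 n a)%:~R <= 4 * dot w (AR *m w) ^+ 2).
  pose p : R := (numq eps)%:~R; pose q : R := (denq eps)%:~R.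
  have q0 : 0 < q by rewrite ltr0z denq_gt0.
  have -> : ratr eps = p / q :> R by [].
  have -> : (s 3%N 0 != 0) = (p * p * ((frob2 n a)%:~R * (d * d * (d * d))) <=
      4 * (g * g * (q * q))).
    have -> : 4 = 4%:Z%:~R :> R by [].
    rewrite -!intrM ler_int s30 -/z; set L := _ * _; set M := numq eps * _ * _.
    have -> : (0 < L + 1 - M) = (M <= L) by rewrite subr_gt0 ltzD1.
    by case: ifP.
  by rewrite -thE clear_denominators.
have H_etaR : 1 <= H%:R * ratr eta :> R.
  by rewrite -(ratr_nat R) -rmorphM /= -(rmorph1 (@ratr R)) ler_rat.
have eps_gt0R : 0 < ratr eps :> R by rewrite ltr0q.
have eta_gt0R : 0 < ratr eta :> R by rewrite ltr0q.
have wE' : w = householder j0 (powit AR c%:~R sg (2 * N0) (K%:R *: delta_mx i0 0)) rho%:~R.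
  by rewrite /w xE.
split=> [large|]; rewrite test.
  rewrite wE'.
  exact: (selected_test ARsym lam_max n_gt0 c_gt0 sg_om sel_pos sel_neg H1 F2E
    F_gt0 c2_ge c2_le N_ge K_gt0 c_ge1 K_ge m_le m_ge mv_ge0 eps_gt0R).
move=> ok; rewrite /read_output -[_ == _]negbK test ok.
do 2!eexists; split; first by [].
have -> : ratr ((s 3%N 1)%:Q / (s 3%N 2%:Z)%:Q) = dot w (AR *m w) :> R.
  by rewrite -thE fmorph_div /= !ratr_int s31 s32 intrM.
have -> : map_mx ratr (\col_(i < n) ((s 4%N i%:Z)%:Q / (s 5%N i%:Z)%:Q)) = w.
  apply/colP => i; rewrite -wE !mxE fmorph_div /= !ratr_int.
  by rewrite s4 ?s5 // mulrC.
move: ok; rewrite wE' => ok.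
exact: (selected_approx ARsym lam_max n_gt0 c_gt0 sg_om sel_pos sel_neg sel_strict
  H1 F2E F_gt0 c2_ge c2_le N_ge K_gt0 c_ge1 K_ge m_le m_ge mv_ge0 H_etaR eta_gt0R ok).
Qed.

End Correctness.

(** * Resources *)

Lemma input_holds_matrix n (A : 'M[int]_n) eps eta : (0 < n)%N ->
  holds_matrix n (entry A) (input_store A eps eta).
Proof.
move=> n0; split=> // i j i_n j_n.
by rewrite /= divnMDl // divn_small // addn0 modnMDl modn_small.
Qed.

Lemma input_bounded n (A : 'M[int]_n) eps eta b W :
  (forall i j, (`|A i j| <= 2 ^ b)%N) -> (b < W)%N -> (n <= W)%N ->
  (rat_bitlen eps + rat_bitlen eta <= W)%N -> bounded_store W (input_store A eps eta).
Proof.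
move=> Ab bW nW rW.
have W0 : (0 < 2 ^ W)%N by rewrite expn_gt0.
have blt z : (bitlen z <= rat_bitlen eps + rat_bitlen eta)%N -> (`|z| < 2 ^ W)%N.
  move=> h; apply: leq_trans (bitlen_gt z) _.
  by rewrite leq_pexp2l // (leq_trans h).
have nlt : (n < 2 ^ W)%N by apply: leq_ltn_trans nW _; exact: ltn_expl.
case=> [|[|[|a]]] [k|k] //=.
- by case: k => [|k] //=.
- case: insubP => [p _ _|_] //; case: insubP => [q _ _|_] //.
  by apply: leq_ltn_trans (Ab _ _) _; rewrite ltn_exp2l.
- by case: k => [|[|[|[|k]]]] //; apply: blt; rewrite /rat_bitlen; lia.
Qed.

(** An exponent of 2 for [sbound] at [BA = 2 ^ b], factor by factor, with [12 <= 2 ^ 4] and the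
    crude [x <= 2 ^ x] for [n] and [H]. *)
Definition bits (n b H : nat) : nat :=
  (1 + n + b + (4 + n + H + (2 * n + 2 * b + 2) *
    (2 * (128 * (n * (n * n) * (H * H))))))%N.

Lemma sbound_le n b H : (sbound n (2 ^ b) H <= 2 ^ bits n b H)%N.
Proof.
rewrite /sbound /bits; move: (128 * _)%N => N.
have nn : (n <= 2 ^ n)%N by exact: ltnW (ltn_expl _ _).
have HH : (H <= 2 ^ H)%N by exact: ltnW (ltn_expl _ _).
rewrite (expnD 2 (1 + n + b)) (expnD 2 (4 + n + H)).
apply: leq_mul.
  by rewrite !expnD; apply: leq_mul => //; apply: leq_mul.
apply: leq_mul.
  by rewrite !expnD -mulnA; apply: leq_mul => //; apply: leq_mul.
rewrite [leqRHS]expnM; case: (posnP (2 * N)) => [->|N0]; first by rewrite ?expn0.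
rewrite leq_exp2r //.
have E : (2 ^ (2 * n + 2 * b + 2) = 2 ^ n * 2 ^ n * (2 ^ b * 2 ^ b) * 4)%N.
  by rewrite !mul2n -!addnn !expnD.
rewrite E.
have b0 : (0 < 2 ^ b)%N by rewrite expn_gt0.
have n0 : (0 < 2 ^ n)%N by rewrite expn_gt0.
have h1 : (n * n * (2 ^ b * 2 ^ b) <= 2 ^ n * 2 ^ n * (2 ^ b * 2 ^ b))%N.
  by apply: leq_mul => //; apply: leq_mul.
have h2 : (n * 2 ^ b <= 2 ^ n * 2 ^ n * (2 ^ b * 2 ^ b))%N.
  by apply: leq_mul; [rewrite (leq_trans nn) // leq_pmulr | rewrite leq_pmulr].
have h3 : (0 < 2 ^ n * 2 ^ n * (2 ^ b * 2 ^ b))%N by rewrite !muln_gt0 n0 b0.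
move: h1 h2 h3; move: (2 ^ n * 2 ^ n * (2 ^ b * 2 ^ b))%N => P.
by move: (n * n * (2 ^ b * 2 ^ b))%N (n * 2 ^ b)%N => X1 X2; lia.
Qed.

(** The degree 6 is 5 for the iteration count [n^3 H^2] plus 1 for the bits gained at each
    iteration. *)
Lemma bits_le : exists2 E, (0 < E)%N &
  forall n b H Y, Y = (n + b + H)%N -> (0 < n)%N -> (0 < H)%N ->
  (30 * bits n b H + n * n + 128 * (n * (n * n) * (H * H)) <= E * Y ^ 6)%N.
Proof.
(* The main term contributes [30 * 256 * 4 = 30720]; the others fit into the remainder. *)
exists (32 * 1000)%N => [|n b H Y YE n0 H0]; first by rewrite muln_gt0.
rewrite /bits.
have nY : (n <= Y)%N by lia.
have HY : (H <= Y)%N by lia.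
have Y0 : (0 < Y)%N by exact: leq_trans nY.
have gY : (2 * n + 2 * b + 2 <= 4 * Y)%N by lia.
have N5 : (n * (n * n) * (H * H) <= Y ^ 5)%N.
  have -> : (Y ^ 5 = Y * (Y * Y) * (Y * Y))%N by rewrite !expnS expn0 muln1 !mulnA.
  by rewrite !leq_mul.
have Y16 : (Y <= Y ^ 6)%N by rewrite -{1}(expn1 Y) leq_pexp2l.
have Y26 : (n * n <= Y ^ 6)%N.
  by apply: leq_trans (leq_mul nY nY) _; rewrite mulnn leq_pexp2l.
have Y56 : (Y ^ 5 <= Y ^ 6)%N by rewrite leq_pexp2l.
have P6 : ((2 * n + 2 * b + 2) * (n * (n * n) * (H * H)) <= 4 * Y ^ 6)%N.
  by apply: leq_trans (leq_mul gY N5) _; rewrite -mulnA -expnS.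
have bY : (2 * n + b + H <= 2 * Y)%N by lia.
move: P6 N5 Y16 Y26 Y56 bY nY Y0 => {gY HY YE}.
have -> : ((2 * n + 2 * b + 2) * (2 * (128 * (n * (n * n) * (H * H)))) =
  256 * ((2 * n + 2 * b + 2) * (n * (n * n) * (H * H))))%N by lia.
move: ((2 * n + 2 * b + 2) * (n * (n * n) * (H * H)))%N => P.
move: (n * (n * n) * (H * H))%N => M; move: (n * n)%N => Q.
by move: (Y ^ 6)%N (Y ^ 5)%N => Y6 Y5; lia.
Qed.

Lemma exprD_le (F : realFieldType) (x y : F) d : 0 <= x -> 0 <= y ->
  (x + y) ^+ d <= 2 ^+ d * (x ^+ d + y ^+ d).
Proof.
move=> x0 y0.
have half (u v : F) : 0 <= u -> 0 <= v -> u <= v ->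
    (u + v) ^+ d <= 2 ^+ d * (u ^+ d + v ^+ d).
  move=> u0 v0 uv; apply: (@le_trans _ _ ((2 * v) ^+ d)).
    by rewrite lerXn2r ?nnegrE ?addr_ge0 ?mulr_ge0 //; lra.
  by rewrite exprMn ler_wpM2l ?exprn_ge0 // lerDr exprn_ge0.
have [xy|/ltW yx] := lerP x y; first exact: half.
by rewrite addrC (addrC (x ^+ d)) half.
Qed.

(** The 64 is [2 ^ 6] from [Y <= 2 X]; the other 2 comes from [exprD_le], which separates the
    parameters from the length [r] of the rational inputs. *)
Lemma time_bound (t c d W Y r E : nat) (X : rat) : 1 <= X -> Y%:R <= 2 * X ->
  (0 < r)%N -> (0 < E)%N -> (t <= c * W ^ d)%N -> (W <= E * Y ^ 6 + r)%N ->
  t%:R <= (c * (2 * (64 * E)) ^ d)%N%:R * X ^+ (6 * d)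
    + (c * (2 * (64 * E)) ^ d)%N%:R * r%:R ^+ (6 * d) :> rat.
Proof.
move=> X1 YX r0 E0 tW WY; set D := (64 * E)%N.
have X0 : 0 <= X by lra.
have r1 : 1 <= r%:R :> rat by rewrite ler1n.
have WX : W%:R <= D%:R * X ^+ 6 + r%:R.
  have : W%:R <= (E * Y ^ 6 + r)%N%:R :> rat by rewrite ler_nat.
  rewrite natrD [(_ * Y ^ 6)%N%:R]natrM natrX => h; apply: le_trans h _.
  rewrite lerD2r; have : Y%:R ^+ 6 <= (2 * X) ^+ 6.
    by rewrite lerXn2r ?nnegrE ?ler0n //; lra.
  rewrite exprMn => h; apply: le_trans (ler_wpM2l (ler0n _ _) h) _.
  by rewrite mulrA ler_wpM2r ?exprn_ge0 // -natrX -natrM ler_nat mulnC.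
have D1 : 1 <= D%:R :> rat by rewrite ler1n muln_gt0.
apply: (@le_trans _ _ (c%:R * W%:R ^+ d)).
  by rewrite -natrX -natrM ler_nat.
rewrite -mulrDr natrM -mulrA; apply: ler_wpM2l => //.
apply: (@le_trans _ _ ((D%:R * X ^+ 6 + r%:R) ^+ d)).
  by rewrite lerXn2r ?nnegrE ?addr_ge0 ?mulr_ge0 ?exprn_ge0.
apply: le_trans (exprD_le _ _ _) _; rewrite ?mulr_ge0 ?exprn_ge0 //.
rewrite natrX natrM [(2 * D%:R) ^+ d]exprMn -[leRHS]mulrA ler_wpM2l ?exprn_ge0 // mulrDr lerD //.
  by rewrite exprMn -exprM.
apply: (@le_trans _ _ (r%:R ^+ (6 * d))).
  by rewrite ler_weXn2l // leq_pmull.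
by rewrite ler_peMl ?exprn_ge0 // exprn_ege1.
Qed.

Theorem theorem7 (R : realType) :
  exists (c : cmd) (C k : nat),
  forall (n b : nat) (A : 'M[int]_n) (eps eta : rat),
    A^T = A ->
    (forall i j, `|A i j| < 2 ^+ b) ->
    A != 0 ->
    0 < eps -> 0 < eta ->
    exists (s : store) (t : nat),
      [/\ exec c (input_store A eps eta) s t,
          t%:R <= C%:R * (n%:R + b%:R + eps^-1 + eta^-1) ^+ k
                  + C%:R * (rat_bitlen eps + rat_bitlen eta)%:R ^+ k :> rat
        & forall lam : R,
            let AR : 'M[R]_n := map_mx intr A in
            is_lambda_max AR lam ->
            (ratr eps * frobenius_norm AR <= `|lam| ->
               outputs_approx_eigenpair AR (ratr eps) (ratr eta) lam
                 (read_output n s)) /\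
            (`|lam| < ratr eps * frobenius_norm AR ->
               read_output n s = SmallMaxEigenvalue \/
               outputs_approx_eigenpair AR (ratr eps) (ratr eta) lam
                 (read_output n s))].
Proof.
have [E E0 bitsE] := bits_le.
exists Eigen, (ccost Eigen * (2 * (64 * E)) ^ depth Eigen)%N.
(* [W] has degree 6 in the parameters, and the time has degree [depth Eigen] in [W]. *)
exists (6 * depth Eigen)%N => n b A eps eta Asym A_lt A_neq0 eps0 eta0.
have n0 : (0 < n)%N.
  by case: n A A_neq0 {Asym A_lt} => // A /eqP[]; apply/matrixP => -[].
have [H HE [H0 H_eta H_le]] := inverse_upper_bound eta0.
have A_le i j : (`|A i j| <= 2 ^ b)%N.
  have := ltW (A_lt i j); have -> : 2 ^+ b = (2 ^ b)%N%:Z by rewrite -natz natrX.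
  by rewrite -abszE lez_nat.
have a_le i j : (i < n)%N -> (j < n)%N -> (`|entry A i j| <= 2 ^ b)%N.
  by move=> i_n j_n; rewrite (entryE A (Ordinal i_n) (Ordinal j_n)) A_le.
set r := (rat_bitlen eps + rat_bitlen eta)%N.
have r0 : (0 < r)%N by rewrite /r /rat_bitlen /bitlen; lia.
pose N0 := (128 * (n * (n * n) * (H * H)))%N.
(* One summand per demand: the 30th power of [sbound], the loop lengths, and the lengths of [eps]
   and [eta]. *)
pose W := (30 * bits n b H + n * n + N0 + r)%N.
have bitsW : (30 * bits n b H <= W)%N by rewrite /W -!addnA leq_addr.
have nb : (1 + n + b <= bits n b H)%N by rewrite /bits leq_addr.
have nW : (n * n <= W)%N by rewrite /W; lia.
have n2W : (n + n <= W)%N by lia.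
have NW : (N0 <= W)%N by rewrite /W; lia.
have QW : (sbound n (2 ^ b) H ^ 30 <= 2 ^ W)%N.
  apply: (@leq_trans ((2 ^ bits n b H) ^ 30)); first by rewrite leq_exp2r ?sbound_le.
  by rewrite -expnM leq_pexp2l // mulnC.
have bd : bounded_store W (input_store A eps eta).
  by apply: (input_bounded A_le); lia.
have BA0 : (0 < 2 ^ b)%N by rewrite expn_gt0.
have W0 : (0 < W)%N by lia.
have spec := wp_eigen n0 BA0 H0 a_le nW n2W NW QW (input_holds_matrix A eps eta n0)
  erefl HE.
have [s [t [run post _ tW]]] := wp_sound W0 bd spec.
exists s, t; split; first exact: run.
  have X1 : 1 <= n%:R + b%:R + eps^-1 + eta^-1.
    have : 1 <= n%:R :> rat by rewrite ler1n.
    have := ler0n rat b; have : 0 < eps^-1 by rewrite invr_gt0.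
    have : 0 < eta^-1 by rewrite invr_gt0.
    by lra.
  apply: (time_bound X1 _ r0 E0 tW (Y := (n + b + H)%N)).
    rewrite !natrD; have : 0 < eps^-1 by rewrite invr_gt0.
    by move: H_le X1; have := ler0n rat b; have := ler0n rat n; lra.
  by rewrite /W leq_add2r; exact: bitsE.
move=> lam AR lam_max.
have [large out] := eigen_post_correct n0 Asym A_neq0 eps0 eta0 H0 H_eta post lam_max.
split=> [/large/out //|_].
have [f0|/out ?] := eqVneq (s 3%N 0) 0; last by right.
by left; rewrite /read_output f0 eqxx.
Qed.
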